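(* Let $\Gamma$ be a finite simplicial graph, let $W_\Gamma$ be the associated right-angled Coxeter group, and suppose that $W_\Gamma$ has no (non-trivial) finite direct factors. Let $Y_\Gamma$ denote the universal cover of its Davis complex, and let $\mathcal{C}(Y_\Gamma)$ be the contact graph of $Y_\Gamma$. Then: (1) $Y_\Gamma$ has no extremal vertices, so the natural homomorphism $\iota\colon\mathrm{Aut}\,Y_\Gamma\to\mathrm{Aut}\,\mathcal{C}(Y_\Gamma)$ is injective. (2) $Y_\Gamma$ has a hyperplane with extremal vertices if and only if there exist distinct vertices $a,b\in\Gamma^{(0)}$ with $\mathrm{st}\,a\subseteq\mathrm{st}\,b$. In this case, the subgroup $\iota(\mathrm{Aut}\,Y_\Gamma)<\mathrm{Aut}\,\mathcal{C}(Y_\Gamma)$ has infinite index. (3) The homomorphism $\rho\colon\mathrm{Aut}\,\mathcal{C}(Y_\Gamma)\to S(Y_\Gamma^{(0)})$ is injective if and only if there do not exist distinct vertices $a,b\in\Gamma^{(0)}$ with $\mathrm{st}\,a=\mathrm{st}\,b$. When $\rho$ is not injective, its kernel is an uncountable torsion subgroup.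
   Context: $W_\Gamma$ is generated by the vertices of $\Gamma$, subject to the relations $a^2=1$ for all $a\in\Gamma^{(0)}$ and $ab=ba$ whenever $a,b$ are adjacent. $Y_\Gamma$ is the $\mathrm{CAT}(0)$ cube complex whose $1$-skeleton is the Cayley graph of $W_\Gamma$ with respect to the generating set $\Gamma^{(0)}$ (with a single edge joining $g$ and $ga$), and with a cube spanned by each coset of a subgroup generated by pairwise adjacent vertices of $\Gamma$; links of vertices of $Y_\Gamma$ are all isomorphic to $\Gamma$. For $a\in\Gamma^{(0)}$, the star $\mathrm{st}\,a\subseteq\Gamma^{(0)}$ consists of $a$ and all vertices adjacent to $a$. For a $\mathrm{CAT}(0)$ cube complex $X$: $\mathrm{Aut}\,X$ is the group of cubical automorphisms and $S(X^{(0)})$ is the group of all permutations of the vertex set. The carrier of a hyperplane is the union of all cubes intersecting it. The contact graph $\mathcal{C}(X)$ has the hyperplanes of $X$ as vertices, two distinct hyperplanes being joined by an edge if and only if no third hyperplane separates them (equivalently, their carriers intersect); graph automorphisms are adjacency-preserving self-bijections of the vertex set (in both directions). The natural homomorphism $\iota\colon\mathrm{Aut}\,X\to\mathrm{Aut}\,\mathcal{C}(X)$ is induced by the action on hyperplanes. The link $\mathrm{lk}\,v$ of a vertex $v$ is the graph with a vertex for each edge of $X$ incident to $v$, two being joined by an edge when the corresponding edges of $X$ span a square. A vertex $v$ is extremal if $\mathrm{lk}\,v$ is a cone, i.e. the join of a (possibly empty) graph and a single vertex. Every hyperplane $\mathfrak{w}$ is itself a $\mathrm{CAT}(0)$ cube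 complex, with cubes the intersections of $\mathfrak{w}$ with cubes of $X$; extremal vertices of hyperplanes refer to this structure. For a vertex $v$, let $\mathscr{W}_v$ be the set of hyperplanes crossing an edge incident to $v$ (equivalently, whose carrier contains $v$). When $X$ is uniformly locally finite with no extremal vertices, $v\mapsto\mathscr{W}_v$ is a bijection from $X^{(0)}$ to the set of maximal cliques of $\mathcal{C}(X)$, and $\rho\colon\mathrm{Aut}\,\mathcal{C}(X)\to S(X^{(0)})$ is the homomorphism defined by $\mathscr{W}_{\rho(\phi)(v)}=\phi(\mathscr{W}_v)$. In part (3), $\rho$ is this homomorphism for $X=Y_\Gamma$. A torsion group is one all of whose elements have finite order. *)

(* Defs.v *)
From HB Require Import structures.
From Stdlib Require Import Relation_Operators.
From mathcomp Require Import all_boot generic_quotient.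
From mathcomp Require Import boolp classical_sets functions cardinality.

Set Implicit Arguments.
Unset Strict Implicit.
Unset Printing Implicit Defensive.

Local Open Scope classical_set_scope.
Local Open Scope card_scope.
Local Open Scope quotient_scope.
Local Open Scope group_scope.

Section GroupNotions.
Context {G : groupType}.
Implicit Types H K A : set G.

Definition subgroup H :=
  [/\ H 1, forall x y, H x -> H y -> H (x * y) & forall x, H x -> H x^-1].

Definition generated A : set G := smallest subgroup A.

Definition lcoset (g : G) H : set G := [set g * h | h in H].

Definition infinite_index H := infinite_set [set lcoset g H | g in setT].

Definition torsion H := forall x, H x -> exists2 n, (0 < n)%N & x ^+ n = 1.

Definition direct_decomposition H K :=
  [/\ subgroup H, subgroup K, forall h k, H h -> K k -> h * k = k * h,
      H `&` K = [set 1] & forall g, exists h k, [/\ H h, K k & g = h * k]].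

End GroupNotions.

Definition no_finite_direct_factor (G : groupType) :=
  forall H K : set G, direct_decomposition H K -> finite_set H -> H = [set 1].

Definition kernel (G H : groupType) (f : G -> H) : set G := [set x | f x = 1].

(** The symmetric group of a possibly infinite type, with [(s * t) x = s (t x)]. *)

Record sym (T : Type) := Sym {
  sym_fun :> T -> T;
  sym_inv : T -> T;
  sym_funK : cancel sym_fun sym_inv;
  sym_invK : cancel sym_inv sym_fun }.

Section SymGroup.
Context {T : Type}.
Implicit Types s t : sym T.

Lemma symP s t : sym_fun s = sym_fun t -> s = t.
Proof.
case: s t => [f f' fK f'K] [g g' gK g'K] /= efg; subst g.
have efg' : f' = g' by apply: funext => x; rewrite -{1}[x]g'K fK.
by subst g'; congr Sym; exact: Prop_irrelevance.
Qed.

HB.instance Definition _ := gen_eqMixin (sym T).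
HB.instance Definition _ := gen_choiceMixin (sym T).

Definition sym_one := @Sym T id id (fun=> erefl) (fun=> erefl).
Definition sym_mul s t := @Sym T (s \o t) (sym_inv t \o sym_inv s)
  (can_comp (sym_funK s) (sym_funK t)) (can_comp (sym_invK t) (sym_invK s)).
Definition sym_Inv s := Sym (sym_invK s) (sym_funK s).

Fact sym_mulA : associative sym_mul. Proof. by move=> s t u; apply: symP. Qed.
Fact sym_mul1s : left_id sym_one sym_mul. Proof. by move=> s; apply: symP. Qed.
Fact sym_muls1 : right_id sym_one sym_mul. Proof. by move=> s; apply: symP. Qed.
Fact sym_mulVs : left_inverse sym_one sym_Inv sym_mul.
Proof. by move=> s; apply: symP; apply: funext => x /=; rewrite sym_funK. Qed.
Fact sym_mulsV : right_inverse sym_one sym_Inv sym_mul.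
Proof. by move=> s; apply: symP; apply: funext => x /=; rewrite sym_invK. Qed.

HB.instance Definition _ := isGroup.Build (sym T)
  sym_mulA sym_mul1s sym_muls1 sym_mulVs sym_mulsV.

End SymGroup.

Record graph := Graph { node : Type; adjacent : node -> node -> Prop }.

Definition is_cone (G : graph) :=
  exists x : node G, forall y, y <> x -> adjacent x y.

Section GraphAut.
Variable G : graph.

Definition is_graph_aut : {pred sym (node G)} :=
  fun s => `[< forall x y, adjacent x y <-> adjacent (s x) (s y) >].

Lemma is_graph_autP (s : sym (node G)) :
  reflect (forall x y, adjacent x y <-> adjacent (s x) (s y))
    (s \in is_graph_aut).
Proof. exact: asboolP. Qed.

Fact graph_aut_closed : group_closed is_graph_aut.
Proof.
split=> [|s t /is_graph_autP sP /is_graph_autP tP]; first exact/is_graph_autP.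
by apply/is_graph_autP => x y; rewrite -sP [X in _ <-> X]tP /= !sym_invK.
Qed.

Record graph_aut := GraphAut {
  graph_aut_sym :> sym (node G);
  graph_autP : graph_aut_sym \in is_graph_aut }.

HB.instance Definition _ := [isSub for graph_aut_sym].
HB.instance Definition _ := [Choice of graph_aut by <:].
HB.instance Definition _ :=
  SubChoice_isSubGroup.Build (sym (node G)) is_graph_aut graph_aut
    graph_aut_closed.

End GraphAut.

(** In a CAT(0) cube complex a cube is determined by its set of vertices, and a
    cubical automorphism by its action on vertices. A complex is recorded as the
    family of vertex sets of its cubes; an n-cube has 2^n vertices. *)
Record cube_complex := CubeComplex {
  vertex : Type;
  cube : set (set vertex) }.

Section CubeComplex.
Variable X : cube_complex.
Implicit Types (v : vertex X) (e f : set (vertex X)).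

Definition edge : set (set (vertex X)) := [set e | cube e /\ e #= `I_2].
Definition square : set (set (vertex X)) := [set s | cube s /\ s #= `I_4].

Definition link v : graph :=
  @Graph {e | edge e /\ e v} (fun a b =>
    a <> b /\ exists2 s, square s & sval a `<=` s /\ sval b `<=` s).

Definition extremal v := is_cone (link v).

Definition opposite e f :=
  [/\ edge e, edge f, e `&` f = set0 &
      exists2 s, square s & e `<=` s /\ f `<=` s].

(** A hyperplane is represented by the set of edges that it crosses, which is a
    class of the equivalence relation generated by being opposite in a square. *)
Definition is_hyperplane (h : set (set (vertex X))) :=
  exists2 e, edge e & h = [set f | clos_refl_sym_trans _ opposite e f].

Record hyperplane := Hyperplane {
  dual_edges :> set (set (vertex X));
  hyperplaneP : is_hyperplane dual_edges }.

Implicit Types h u w : hyperplane.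

Lemma hyperplane_inj u w : dual_edges u = dual_edges w -> u = w.
Proof.
case: u w => [u uP] [w wP] /= euw; subst w.
by congr Hyperplane; exact: Prop_irrelevance.
Qed.

Definition hyperplanes_at v : set hyperplane :=
  [set h | exists2 e, dual_edges h e & e v].

Definition same_side h : vertex X -> vertex X -> Prop :=
  clos_refl_trans _ (fun x y => edge [set x; y] /\ ~ dual_edges h [set x; y]).

Definition halfspace h (A : set (vertex X)) := exists x, A = same_side h x.

(** The complementary component [A] contains [u] when it contains the endpoints
    of all the edges crossed by [u]. *)
Definition separates h u w := exists A B,
  [/\ halfspace h A, halfspace h B, A <> B,
      (forall e, dual_edges u e -> e `<=` A) &
      (forall e, dual_edges w e -> e `<=` B)].

Definition contact_graph : graph :=
  @Graph hyperplane (fun u w =>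
    u <> w /\ ~ exists h, [/\ h <> u, h <> w & separates h u w]).

(** The vertices of a hyperplane are the midpoints of the edges it crosses, and
    its cubes are its nonempty intersections with the cubes of [X]. *)
Definition hyperplane_complex h : cube_complex :=
  @CubeComplex {e | dual_edges h e}
    [set D | D !=set0 /\
             exists2 C, cube C & D = [set m | sval m `<=` C]].

Definition is_cube_aut : {pred sym (vertex X)} :=
  fun s => `[< forall C, cube C <-> cube (s @` C) >].

Lemma is_cube_autP (s : sym (vertex X)) :
  reflect (forall C, cube C <-> cube (s @` C)) (s \in is_cube_aut).
Proof. exact: asboolP. Qed.

Lemma sym_imageK (s : sym (vertex X)) : cancel (image^~ s) (image^~ (s^-1)%g).
Proof.
by move=> C; rewrite image_comp -[RHS]image_id; apply: eq_imagel => x _ /=;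
  rewrite sym_funK.
Qed.

Lemma sym_imageVK (s : sym (vertex X)) : cancel (image^~ (s^-1)%g) (image^~ s).
Proof. by move=> C; have := sym_imageK (s^-1)%g C; rewrite invgK. Qed.

Fact cube_aut_closed : group_closed is_cube_aut.
Proof.
split=> [|s t /is_cube_autP sP /is_cube_autP tP].
  by apply/is_cube_autP => C; rewrite image_id.
apply/is_cube_autP => C.
have -> : (s * t^-1)%g @` C = s @` ((t^-1)%g @` C) by rewrite image_comp.
by rewrite -sP [X in _ <-> X]tP sym_imageVK.
Qed.

Record cube_aut := CubeAut {
  cube_aut_sym :> sym (vertex X);
  cube_autP : cube_aut_sym \in is_cube_aut }.

HB.instance Definition _ := [isSub for cube_aut_sym].
HB.instance Definition _ := [Choice of cube_aut by <:].
HB.instance Definition _ :=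
  SubChoice_isSubGroup.Build (sym (vertex X)) is_cube_aut cube_aut
    cube_aut_closed.

End CubeComplex.

Section Action.
Variable X : cube_complex.
Implicit Types (s : cube_aut X) (u w h : hyperplane X).

Lemma cube_aut_imageK s : cancel (image^~ s) (image^~ (s^-1)%g).
Proof. exact: sym_imageK. Qed.

Lemma cube_aut_imageVK s : cancel (image^~ (s^-1)%g) (image^~ s).
Proof. exact: sym_imageVK. Qed.

Lemma cube_aut_cube s C : cube C -> cube (s @` C).
Proof. by case: s => s /= /is_cube_autP sP /sP. Qed.

Lemma cube_aut_inj s : injective s.
Proof. exact: can_inj (sym_funK s). Qed.

Lemma cube_aut_card s (C : set (vertex X)) n : C #= `I_n -> s @` C #= `I_n.
Proof.
by apply: card_eq_trans; apply: inj_card_eq => x y _ _; exact: cube_aut_inj.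
Qed.

Lemma cube_aut_edge s e : edge e -> edge (s @` e).
Proof. by case=> ? ?; split; [exact: cube_aut_cube | exact: cube_aut_card]. Qed.

Lemma cube_aut_opposite s e f : opposite e f -> opposite (s @` e) (s @` f).
Proof.
case=> ee ef ef0 [q [cq q4] [eq fq]]; split; [exact: cube_aut_edge..| |].
  rewrite -subset0 => _ [[x xe <-] [y yf /(@cube_aut_inj s) yx]].
  by have: (e `&` f) x by [split=> //; rewrite -yx]; rewrite ef0.
exists (s @` q); last by split; exact: image_subset.
by split; [exact: cube_aut_cube | exact: cube_aut_card].
Qed.

Lemma cube_aut_parallel s e f : clos_refl_sym_trans _ (@opposite X) e f ->
  clos_refl_sym_trans _ (@opposite X) (s @` e) (s @` f).
Proof.
elim=> [a b /(cube_aut_opposite s) ab|a|a b _ ?|a b c _ ab _ bc].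
- exact: rst_step.
- exact: rst_refl.
- exact: rst_sym.
- exact: rst_trans ab bc.
Qed.

Definition image_edges s (h : set (set (vertex X))) := [set s @` e | e in h].

Fact image_hyperplaneP s h : is_hyperplane (image_edges s h).
Proof.
case: h => h /= [e ee ->]; exists (s @` e); first exact: cube_aut_edge.
apply/seteqP; split=> [_ [f /= ef <-]|f /= /(cube_aut_parallel s^-1)].
  exact: cube_aut_parallel.
by rewrite cube_aut_imageK => ef; exists ((s^-1)%g @` f); rewrite ?cube_aut_imageVK.
Qed.

Definition image_hyperplane s h : hyperplane X :=
  Hyperplane (image_hyperplaneP s h).

Fact image_hyperplaneK s :
  cancel (image_hyperplane s) (image_hyperplane s^-1).
Proof.
move=> h; apply: hyperplane_inj => /=; rewrite /image_edges image_comp.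
by rewrite -[RHS]image_id; apply: eq_imagel => e _ /=; rewrite cube_aut_imageK.
Qed.

Fact image_hyperplaneVK s :
  cancel (image_hyperplane s^-1) (image_hyperplane s).
Proof. by move=> h; have := image_hyperplaneK (s^-1)%g h; rewrite invgK. Qed.

Definition hyperplane_sym s : sym (hyperplane X) :=
  Sym (image_hyperplaneK s) (image_hyperplaneVK s).

Lemma image_edgesE s h e : image_edges s h (s @` e) <-> dual_edges h e.
Proof.
split=> [[f hf] /(can_inj (cube_aut_imageK s)) <- //|he]; by exists e.
Qed.

Lemma image_same_side s h x y :
  same_side h x y -> same_side (image_hyperplane s h) (s x) (s y).
Proof.
elim=> [a b [eab hab]|a|a b c _ ab _ bc].
- apply: rt_step; have <- : s @` [set a; b] = [set s a; s b].
    by rewrite image_setU !image_set1.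
  by split; [exact: cube_aut_edge | move/image_edgesE].
- exact: rt_refl.
- exact: rt_trans ab bc.
Qed.

Lemma image_same_sideE s h x :
  s @` same_side h x = same_side (image_hyperplane s h) (s x).
Proof.
apply/seteqP; split=> [_ [y xy <-]|y]; first exact: image_same_side.
move=> /(image_same_side s^-1); rewrite image_hyperplaneK.
have -> : (s^-1)%g (s x) = x by exact: sym_funK.
by move=> xy; exists ((s^-1)%g y) => //; exact: sym_invK.
Qed.

Lemma image_separates s h u w : separates h u w ->
  separates (image_hyperplane s h) (image_hyperplane s u) (image_hyperplane s w).
Proof.
case=> A [B [[x ->] [y ->] AB uA wB]].
exists (s @` same_side h x), (s @` same_side h y); split.
- by exists (s x); exact: image_same_sideE.
- by exists (s y); exact: image_same_sideE.
- by move/(can_inj (cube_aut_imageK s)).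
- by move=> _ [e /uA eA <-]; exact: image_subset.
- by move=> _ [e /wB eB <-]; exact: image_subset.
Qed.

Lemma image_contact s u w : @adjacent (contact_graph X) u w ->
  @adjacent (contact_graph X) (image_hyperplane s u) (image_hyperplane s w).
Proof.
have inj := can_inj (image_hyperplaneK s).
case=> uw nsep; split=> [/inj//|[h [hu hw sep]]].
apply: nsep; exists (image_hyperplane (s^-1)%g h); split.
- by move=> /(congr1 (image_hyperplane s)); rewrite image_hyperplaneVK.
- by move=> /(congr1 (image_hyperplane s)); rewrite image_hyperplaneVK.
- by have := image_separates (s^-1)%g sep; rewrite !image_hyperplaneK.
Qed.

Fact hyperplane_sym_aut s : (hyperplane_sym s : sym (node (contact_graph X)))
  \in @is_graph_aut (contact_graph X).
Proof.
apply/is_graph_autP => u w; split; first exact: image_contact.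
by move=> /(image_contact s^-1); rewrite /= !image_hyperplaneK.
Qed.

(** The natural homomorphism from [Aut X] to the automorphism group of the
    contact graph of [X]. *)
Definition contact_iota s : graph_aut (contact_graph X) :=
  GraphAut (hyperplane_sym_aut s).

Fact contact_iota_morphism : {morph contact_iota : s t / s * t}.
Proof.
move=> s t; apply: val_inj; apply: symP; apply: funext => h.
apply: hyperplane_inj => /=; rewrite /image_edges image_comp.
by apply: eq_imagel => e _ /=; rewrite image_comp.
Qed.

HB.instance Definition _ :=
  isMultiplicative.Build (cube_aut X) (graph_aut (contact_graph X))
    contact_iota contact_iota_morphism.

End Action.

Section Davis.
Context {V : finType}.
Variable adj : rel V.

Definition star (a : V) : {set V} := [set b | (b == a) || adj a b]%SET.

(** As every generator is an involution, the group is presented as a monoid by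
    the same relations, so that words need no formal inverses. *)
Inductive racg_step : seq V -> seq V -> Prop :=
| RacgInvol s t a : racg_step (s ++ [:: a; a] ++ t) (s ++ t)
| RacgComm s t a b of adj a b :
    racg_step (s ++ [:: a; b] ++ t) (s ++ [:: b; a] ++ t).

Definition racg_eq : rel (seq V) :=
  fun s t => `[< clos_refl_sym_trans _ racg_step s t >].

Fact racg_eq_refl : reflexive racg_eq.
Proof. by move=> s; apply/asboolP; exact: rst_refl. Qed.
Fact racg_eq_sym : symmetric racg_eq.
Proof. by move=> s t; apply/asboolP/asboolP; exact: rst_sym. Qed.
Fact racg_eq_trans : transitive racg_eq.
Proof.
by move=> t s u /asboolP st /asboolP tu; apply/asboolP; exact: rst_trans st tu.
Qed.

Canonical racg_equiv := EquivRel racg_eq racg_eq_refl racg_eq_sym racg_eq_trans.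

Definition racg := {eq_quot racg_equiv}.
HB.instance Definition _ := Choice.on racg.
HB.instance Definition _ := EqQuotient.on racg.

Definition racg_word (s : seq V) : racg := \pi_racg s.

Lemma racg_wordP s t :
  racg_word s = racg_word t <-> clos_refl_sym_trans _ racg_step s t.
Proof.
by split=> [/eqquotP /asboolP | st]; last apply/eqquotP/asboolP.
Qed.

Lemma racg_step_cat p q s t :
  racg_step s t -> racg_step (p ++ s ++ q) (p ++ t ++ q).
Proof.
case=> [s' t' a|s' t' a b ab]; rewrite -!catA !(catA p).
  exact: RacgInvol.
exact: RacgComm.
Qed.

Lemma racg_word_cat s s' t t' : racg_word s = racg_word s' ->
  racg_word t = racg_word t' -> racg_word (s ++ t) = racg_word (s' ++ t').
Proof.
have aux p q u v : racg_word u = racg_word v ->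
    racg_word (p ++ u ++ q) = racg_word (p ++ v ++ q).
  move=> /racg_wordP uv; apply/racg_wordP; elim: uv => {u v}.
  - by move=> u v uv; apply: rst_step; exact: racg_step_cat.
  - by move=> u; exact: rst_refl.
  - by move=> u v _ ?; exact: rst_sym.
  - by move=> u v w _ uv _ vw; exact: rst_trans uv vw.
move=> /(aux [::] t) ss' /(aux s' [::]); rewrite !cats0 => tt'.
exact: etrans ss' tt'.
Qed.

Lemma racg_word_rev s t :
  racg_word s = racg_word t -> racg_word (rev s) = racg_word (rev t).
Proof.
move=> /racg_wordP st; apply/racg_wordP; elim: st => {s t}.
- move=> s t [] => [u v a|u v a b ab]; rewrite !rev_cat -!catA.
    by apply: rst_step; exact: RacgInvol.
  by apply: rst_sym; apply: rst_step; exact: RacgComm.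
- by move=> u; exact: rst_refl.
- by move=> u v _ ?; exact: rst_sym.
- by move=> u v w _ uv _ vw; exact: rst_trans uv vw.
Qed.

Lemma racg_repr (x : racg) : racg_word (repr x) = x.
Proof. exact: reprK. Qed.

Definition racg_one : racg := racg_word [::].
Definition racg_mul (x y : racg) : racg := racg_word (repr x ++ repr y).
Definition racg_inv (x : racg) : racg := racg_word (rev (repr x)).

Lemma racg_mulE s t : racg_mul (racg_word s) (racg_word t) = racg_word (s ++ t).
Proof. by apply: racg_word_cat; exact: racg_repr. Qed.

Fact racg_mulA : associative racg_mul.
Proof.
by move=> x y z; rewrite -[x]racg_repr -[y]racg_repr -[z]racg_repr !racg_mulE
  catA.
Qed.
Fact racg_mul1 : left_id racg_one racg_mul.
Proof. by move=> x; rewrite -[x]racg_repr racg_mulE. Qed.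
Fact racg_1mul : right_id racg_one racg_mul.
Proof. by move=> x; rewrite -[x]racg_repr racg_mulE cats0. Qed.

Lemma racg_rev_cat s : racg_word (rev s ++ s) = racg_one.
Proof.
elim: s => // a s IHs; rewrite rev_cons -cats1 -catA -[RHS]IHs.
by apply/racg_wordP; apply: rst_step; exact: RacgInvol.
Qed.

Fact racg_mulV : left_inverse racg_one racg_inv racg_mul.
Proof. by move=> x; rewrite -{2}[x]racg_repr racg_mulE racg_rev_cat. Qed.
Fact racg_Vmul : right_inverse racg_one racg_inv racg_mul.
Proof.
move=> x; rewrite -{1}[x]racg_repr racg_mulE -{1}[repr x]revK.
exact: racg_rev_cat.
Qed.

HB.instance Definition _ := isGroup.Build racg
  racg_mulA racg_mul1 racg_1mul racg_mulV racg_Vmul.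

Definition racg_gen (a : V) : racg := racg_word [:: a].

Definition clique (T : {set V}) := {in T &, forall a b, a != b -> adj a b}.

(** The universal cover of the Davis complex. The cliques of cardinality 0 and 1
    give the vertices [{g}] and the edges [{g, g * a}]. *)
Definition davis : cube_complex := @CubeComplex racg
  [set C | exists (g : racg) (T : {set V}), clique T /\
           C = lcoset g (generated (racg_gen @` [set` T]))].

End Davis.

(* Main.v *)
(** Write [st a] for the star of [a], [<T>] for the special subgroup generated
    by [T], and [W_v] for the set of hyperplanes at a vertex [v].

    The hyperplanes of the Davis complex correspond to the pairs [(a, g <st a>)],
    the coset being the set of vertices of the carrier. Counting modulo 2 how
    often a path crosses a hyperplane gives a well-defined side function, and a
    shortest path between two disjoint cosets of special subgroups starts with
    an edge whose hyperplane separates them. Hence hyperplanes are in contact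
    exactly when they have a common vertex, cosets satisfy the Helly property,
    and, when no vertex of the graph is adjacent to all others, the sets [W_v]
    are pairwise distinct maximal cliques permuted by all automorphisms of the
    contact graph; this defines [rho].

    If [st a] is contained in [st b], the identity on one side of the hyperplane
    [(a, g <st a>)] and [g b g^-1] on the other side preserve contacts, and these
    automorphisms lie in pairwise distinct cosets of the image of [iota]. If
    [st a = st b], the hyperplanes [(a, g <st a>)] and [(b, g <st b>)] can be
    exchanged independently for all cosets, which makes the kernel of [rho]
    uncountable; conversely, elements of the kernel permute each finite set
    [W_v], hence are torsion. *)

From HB Require Import structures.
From Stdlib Require Import Relation_Operators.
From mathcomp Require Import all_boot fingroup perm cyclic generic_quotient.
Require Import Defs.
From mathcomp Require Import boolp classical_sets functions cardinality.

Set Implicit Arguments.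
Unset Strict Implicit.
Unset Printing Implicit Defensive.

Local Open Scope classical_set_scope.
Local Open Scope card_scope.
Local Open Scope group_scope.

(** * Words and special subgroups *)

Section Words.
Context {V : finType} {adj : rel V}.
Local Notation W := (racg adj).
Local Notation word := (racg_word adj).
Local Notation gen := (@racg_gen V adj).
Local Notation st := (star adj).
Implicit Types (S T : {set V}) (a b c : V) (s t : seq V) (g h x y z k : W).

Lemma word_invariant X (F : seq V -> X) :
    (forall s t, racg_step adj s t -> F s = F t) ->
  forall s t, word s = word t -> F s = F t.
Proof.
move=> FP s t /racg_wordP; by elim=> // x y z _ -> _ ->.
Qed.

Lemma wordM s t : word (s ++ t) = word s * word t.
Proof. by symmetry; exact: racg_mulE. Qed.

Lemma word_nil : word [::] = 1. Proof. by []. Qed.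

Lemma word_cons c s : word (c :: s) = gen c * word s.
Proof. exact: (wordM [:: c]). Qed.

Lemma word_rcons c s : word (rcons s c) = word s * gen c.
Proof. by rewrite -cats1 wordM. Qed.

Lemma wordV s : (word s)^-1 = word (rev s).
Proof. by apply: mulg1_eq; rewrite -{1}[s]revK -wordM racg_rev_cat. Qed.

Lemma wordE g : exists s, g = word s.
Proof. by exists (repr g); rewrite racg_repr. Qed.

Lemma racg_ind (P : W -> Prop) :
  P 1 -> (forall c g, P g -> P (gen c * g)) -> forall g, P g.
Proof.
move=> P1 PM g; have [s ->] := wordE g.
by elim: s => [|c s IHs]; rewrite ?word_cons //; exact: PM.
Qed.

Lemma genK c : gen c * gen c = 1.
Proof.
by rewrite -wordM; apply/racg_wordP/rst_step/(@RacgInvol _ adj [::] [::]).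
Qed.

Lemma invg_gen c : (gen c)^-1 = gen c. Proof. exact/mulg1_eq/genK. Qed.

Lemma gen_comm a b : adj a b -> gen a * gen b = gen b * gen a.
Proof.
by move=> ab; rewrite -!wordM; apply/racg_wordP/rst_step/(@RacgComm _ adj [::] [::]).
Qed.

Lemma star_refl a : a \in st a. Proof. by rewrite inE eqxx. Qed.

Lemma gen_star_comm a b : b \in st a -> gen a * gen b = gen b * gen a.
Proof. by rewrite inE => /predU1P[->|/gen_comm]. Qed.

Definition ret T g : W := word [seq c <- repr g | c \in T].

(** Deleting the letters outside [T] turns each defining relation into a relation or a trivial
    identity, so [ret T] is a well-defined endomorphism. *)
Lemma ret_word T s : ret T (word s) = word [seq c <- s | c \in T].
Proof.
apply: (word_invariant (F := fun s => word (filter (mem T) s))) (racg_repr _).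
move=> _ _ [] {}s t a => [|b ab]; rewrite !filter_cat /= ?wordM.
  by case: (a \in T); rewrite ?word_cons word_nil ?mulg1 ?genK mul1g.
by case: (a \in T); case: (b \in T); rewrite ?word_cons ?word_nil ?mulg1 ?(gen_comm ab).
Qed.

Lemma retM T g h : ret T (g * h) = ret T g * ret T h.
Proof.
have [s ->] := wordE g; have [t ->] := wordE h.
by rewrite -wordM !ret_word filter_cat wordM.
Qed.

Lemma ret_gen T c : ret T (gen c) = if c \in T then gen c else 1.
Proof. by rewrite ret_word /=; case: ifP. Qed.

Lemma ret_ret S T g : ret S (ret T g) = ret (S :&: T)%SET g.
Proof.
have [s ->] := wordE g; rewrite !ret_word -filter_predI.
by congr (word _); apply: eq_filter => c /=; rewrite inE.
Qed.

(* Membership in [<T>]: the fixed points of the retraction that kills the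
   generators outside [T]. *)
Definition para T g := ret T g == g.

Lemma paraP T g : reflect (exists2 s, all (mem T) s & g = word s) (para T g).
Proof.
apply: (iffP eqP) => [<-|[s /all_filterP sT ->]]; last by rewrite ret_word sT.
by eexists; last reflexivity; exact: filter_all.
Qed.

Lemma para1 T : para T 1. Proof. by apply/paraP; exists [::]. Qed.

Lemma paraM T g h : para T g -> para T h -> para T (g * h).
Proof. by move=> /eqP gT /eqP hT; rewrite /para retM gT hT. Qed.

Lemma paraV T g : para T g -> para T g^-1.
Proof.
by case/paraP => s sT ->; apply/paraP; exists (rev s); rewrite ?wordV ?all_rev.
Qed.

Lemma para_word T s : all (mem T) s -> para T (word s).
Proof. by move=> sT; apply/paraP; exists s. Qed.

Lemma para_gen T c : c \in T -> para T (gen c).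
Proof. by move=> cT; rewrite /para ret_gen cT. Qed.

(** The retractions for [S] and [T] compose to the one for [S :&: T], which settles intersections of
    special subgroups without reduced words. *)
Lemma paraI S T g : para (S :&: T)%SET g = para S g && para T g.
Proof.
apply/eqP/andP => [gE|[/eqP Sg /eqP Tg]]; last by rewrite -ret_ret Tg Sg.
by rewrite /para -{1 3}gE !ret_ret finset.setIA finset.setIid finset.setICA finset.setIid gE.
Qed.

Lemma paraMl T g h : para T g -> para T (g * h) = para T h.
Proof.
by move=> gT; apply/idP/idP => [/(paraM (paraV gT))|]; rewrite ?mulKg // => /(paraM gT).
Qed.

Lemma paraMr T g h : para T h -> para T (g * h) = para T g.
Proof.
move=> hT; apply/idP/idP => [gh|gT]; last exact: paraM.
by have := paraM gh (paraV hT); rewrite mulgK.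
Qed.

Lemma para_sym T x y : para T (x^-1 * y) = para T (y^-1 * x).
Proof. by apply/idP/idP => /paraV; rewrite invgM invgK. Qed.

Lemma para_trans T x y z : para T (x^-1 * y) -> para T (y^-1 * z) = para T (x^-1 * z).
Proof. by move=> xy; rewrite -(paraMl _ xy) mulgA mulgK. Qed.

Lemma para0 g : para finset.set0 g -> g = 1.
Proof. by case/paraP => -[|c s] /=; rewrite ?inE. Qed.

Lemma paraT g : para [set: V]%SET g.
Proof.
by have [s ->] := wordE g; apply: para_word; apply/allP => c; rewrite !inE.
Qed.

Lemma para_ind T (P : W -> Prop) :
  P 1 -> (forall c g, c \in T -> para T g -> P g -> P (gen c * g)) ->
  forall g, para T g -> P g.
Proof.
move=> P1 PM g /paraP[s sT ->]; elim: s sT => //= c s IHs /andP[cT sT].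
by rewrite word_cons; apply: PM => //; [exact: para_word | exact: IHs].
Qed.

Lemma para_ind_r T (P : W -> Prop) :
  P 1 -> (forall c g, c \in T -> para T g -> P g -> P (g * gen c)) ->
  forall g, para T g -> P g.
Proof.
move=> P1 PM g /paraP[s sT ->]; elim/last_ind: s sT => //= s c IHs.
rewrite all_rcons => /andP[cT sT].
by rewrite word_rcons; apply: PM => //; [exact: para_word | exact: IHs].
Qed.

Lemma generatedE T : generated (gen @` [set` T]) = [set g | para T g].
Proof.
apply/seteqP; split=> [|g /=].
  apply: smallest_sub => [|_ [c cT <-]]; last exact: para_gen.
  by split; [exact: para1 | move=> x y; exact: paraM | move=> x; exact: paraV].
elim/para_ind => [|c {}g cT _ IHg] H HP; have [[H1 HM _] sH] := HP => //.
by apply: HM; [apply: sH; exists c | exact: IHg].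
Qed.

Lemma para_star_comm a g : para (st a) g -> gen a * g = g * gen a.
Proof.
elim/para_ind => [|c {}g ca _ IHg]; first by rewrite mulg1 mul1g.
by rewrite mulgA gen_star_comm // -!mulgA IHg.
Qed.

(** The homomorphism to Z/2 sending [a] to 1 and the other generators to 0; it is used below to tell
    elements apart. *)
Definition parity a g := odd (count_mem a (repr g)).

Lemma parity_word a s : parity a (word s) = odd (count_mem a s).
Proof.
apply: (word_invariant (F := fun s => odd (count_mem a s))) (racg_repr _).
move=> _ _ [] {}s t c => [|b _]; rewrite !count_cat /= !addn0 !oddD.
  by rewrite addbb.
by congr (_ (+) (_ (+) _)); rewrite addbC.
Qed.

Lemma parityM a g h : parity a (g * h) = parity a g (+) parity a h.
Proof.
have [s ->] := wordE g; have [t ->] := wordE h.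
by rewrite -wordM !parity_word count_cat oddD.
Qed.

Lemma parity1 a : parity a 1 = false. Proof. exact: (parity_word _ [::]). Qed.

Lemma parity_gen a c : parity a (gen c) = (c == a).
Proof. by rewrite (parity_word a [:: c]) /= addn0 oddb. Qed.

Lemma gen_inj : injective gen.
Proof.
by move=> a b ab; apply/eqP; rewrite -parity_gen ab parity_gen eqxx.
Qed.

Lemma gen_neq1 a : gen a <> 1.
Proof. by move/(congr1 (parity a)); rewrite parity_gen eqxx parity1. Qed.

Lemma para_genE T a : para T (gen a) = (a \in T).
Proof.
by rewrite /para ret_gen; case: ifP; rewrite ?eqxx // => _; apply/eqP => /esym/gen_neq1.
Qed.

End Words.

(** * Sides of hyperplanes, gates and the Helly property *)

Section Sides.
Context {V : finType} {adj : rel V}.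
Hypothesis adj_sym : symmetric adj.
Local Notation W := (racg adj).
Local Notation word := (racg_word adj).
Local Notation gen := (@racg_gen V adj).
Local Notation st := (star adj).
Implicit Types (S T : {set V}) (a b c : V) (s t : seq V) (g h x y z k : W).

Lemma star_sym a b : (a \in st b) = (b \in st a).
Proof. by rewrite !inE eq_sym adj_sym. Qed.

(** The edge from [x] to [x * gen a] is parallel to [{1, a}] exactly when [x] lies in [<st a>],
    whence the test made at each letter. *)
Fixpoint crossings a x s : bool :=
  if s is c :: s' then
    ((c == a) && para (st a) x) (+) crossings a (x * gen c) s'
  else false.

Lemma crossings_cat a x s t :
  crossings a x (s ++ t) = crossings a x s (+) crossings a (x * word s) t.
Proof.
elim: s x => [|c s IHs] x /=; first by rewrite word_nil mulg1.
by rewrite IHs word_cons mulgA addbA.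
Qed.

(* The parity of the number of times that an edge path from [1] to [g] crosses
   the hyperplane dual to the edge [{1, a}]. *)
Definition side1 a g := crossings a 1 (repr g).

(** A cancelled pair [a a] crosses twice or never, since [a] itself lies in [<st a>]. In a
    commutation, a letter swapped with [a] lies in [st a], so the membership test is unaffected. *)
Lemma side1_word a s : side1 a (word s) = crossings a 1 s.
Proof.
apply: (word_invariant (F := crossings a 1)) (racg_repr _) => _ _ [] {}s t c.
  rewrite !crossings_cat; congr (_ (+) _) => /=.
  rewrite addbF !word_cons word_nil mulg1 genK mulg1 mul1g.
  have [->|] := eqVneq c a; last by [].
  by rewrite paraMr ?addbb //; exact/para_gen/star_refl.
move=> d cd; rewrite !crossings_cat; congr (_ (+) _) => /=.
rewrite addbF addbF !word_cons word_nil mulg1 mulg1 mul1g gen_comm //.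
congr (_ (+) _).
have [ca|] := eqVneq c a; have [da|] := eqVneq d a => //=.
- by rewrite da -ca addbC.
- by rewrite addbF paraMr // para_gen // -ca inE cd orbT.
- by rewrite addbF paraMr // para_gen // -da inE adj_sym cd orbT.
Qed.

Lemma side1_gen a g c :
  side1 a (g * gen c) = side1 a g (+) ((c == a) && para (st a) g).
Proof.
have [s ->] := wordE g.
by rewrite -wordM !side1_word crossings_cat /= addbF mul1g.
Qed.

Definition side a g x := side1 a (g^-1 * x).

Lemma side_gen a g x c :
  side a g (x * gen c) = side a g x (+) ((c == a) && para (st a) (g^-1 * x)).
Proof. by rewrite /side mulgA side1_gen. Qed.

Lemma side_base a g : side a g g = false.
Proof. by rewrite /side mulVg -word_nil side1_word. Qed.

Lemma side_crossed a g x s : side a g (x * word s) != side a g x ->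
  exists s1 s2, s = s1 ++ a :: s2 /\ para (st a) (g^-1 * (x * word s1)).
Proof.
elim: s x => [|c s IHs] x; first by rewrite word_nil mulg1 eqxx.
rewrite word_cons mulgA => xs.
have [xc|/IHs[s1 [s2 [-> gx]]]] :=
  eqVneq (side a g (x * gen c * word s)) (side a g (x * gen c)); last first.
  by exists (c :: s1), s2; split; rewrite // word_cons [x * _]mulgA.
move: xs; rewrite xc side_gen; case: (c =P a) => [->|_]; last by rewrite addbF eqxx.
case gx: (para _ _); last by rewrite addbF eqxx.
by exists [::], s; rewrite word_nil mulg1.
Qed.

Lemma side_para T a g x k :
  a \notin T -> para T k -> side a g (x * k) = side a g x.
Proof.
move=> aT /paraP[s sT ->]; apply/eqP/negPn/negP => /side_crossed[s1 [s2 [sE _]]].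
by move: sT; rewrite sE all_cat /= (negbTE aT) andbF.
Qed.

(* A shortest path from [x0<S>] to [y0<T>] works: if it crossed its first
   hyperplane twice, or if this hyperplane crossed [y0<T>], reflecting in it
   would give a shorter path. *)
Lemma gate S T x0 y0 :
    (forall z, para S (x0^-1 * z) -> para T (y0^-1 * z) -> False) ->
  exists x c, [/\ para S (x0^-1 * x), c \notin S &
    forall z, para T (y0^-1 * z) -> side c x z].
Proof.
move=> ST.
pose P n := `[< exists x s,
  [/\ size s = n, para S (x0^-1 * x) & para T (y0^-1 * (x * word s))] >].
have exP : exists n, P n.
  exists (size (repr (x0^-1 * y0))); apply/asboolP.
  exists x0, (repr (x0^-1 * y0)).
  by rewrite racg_repr mulVg mulVKg mulVg !para1.
case: (ex_minnP exP) => n /asboolP[x [s [sn xS yT]]] nmin.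
have minn x' s' : para S (x0^-1 * x') -> para T (y0^-1 * (x' * word s')) ->
    (size s <= size s')%N.
  by move=> x'S y'T; rewrite sn; apply: nmin; apply/asboolP; exists x', s'.
case: s sn yT minn => [|c s] _ yT minn.
  by move: yT; rewrite word_nil mulg1 => /(ST _ xS).
have cS : c \notin S.
  apply/negP => cS; have := minn (x * gen c) s.
  rewrite mulgA paraMr ?para_gen // -[x * gen c * _]mulgA -word_cons /= ltnn.
  by move=> /(_ xS yT).
have sidey : side c x (x * word (c :: s)).
  have sc : side c x (x * gen c).
    by rewrite side_gen side_base mulVg para1 eqxx.
  rewrite word_cons mulgA; case E: (side _ _ _) => //.
  have [|s1 [s2 [sE]]] := @side_crossed c x (x * gen c) s; first by rewrite E sc.
  rewrite -mulgA mulKg paraMl ?para_gen ?star_refl // => s1c.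
  have := minn x (s1 ++ s2); rewrite sE /= !size_cat /= addnS => /(_ xS).
  suff -> : word (s1 ++ s2) = word (c :: s).
    by move=> /(_ yT); rewrite ltnNge leqnSn.
  rewrite sE word_cons !wordM word_cons (mulgA _ (word s1)) (para_star_comm s1c).
  by rewrite -mulgA (mulgA (gen c)) genK mul1g.
exists x, c; split=> // z zT; apply/negPn/negP => zside.
have /paraP[t tT tE] : para T ((x * word (c :: s))^-1 * z).
  by rewrite -(para_trans (y := y0)) // para_sym.
have [|t1 [t2 [tE' ]]] := @side_crossed c x (x * word (c :: s)) t.
  by rewrite -tE mulVKg sidey (negbTE zside).
rewrite -[x * _ * _]mulgA mulKg => /para_star_comm.
move: tT; rewrite tE' all_cat /= => /and3P[t1T cT _].
rewrite word_cons !mulgA genK mul1g => t1s.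
suff yT' : para T (y0^-1 * (x * word s)).
  by have := minn x s xS yT'; rewrite /= ltnn.
(* Deleting [c] reflects the endpoint in the hyperplane dual to [{x, x c}]. As the path [t1] from
   the endpoint leads to this hyperplane inside [y0<T>], the reflection multiplies the endpoint on
   the right by a conjugate of [c] in [<T>]. *)
have -> : x * word s = x * word (c :: s) * (word t1 * gen c * (word t1)^-1).
  by rewrite word_cons -!mulgA; congr (x * _); rewrite !mulgA -t1s mulgK.
have t1P : para T (word t1) by exact: para_word.
by rewrite mulgA paraMr //; apply: paraM (paraM _ (para_gen cT)) (paraV t1P).
Qed.

(** Otherwise [gate] gives a hyperplane with label [c] outside [T :&: U] that has all of [p<S>] on
    its far side. If [c] is not in [T], all of [z<T>] is on the near side, which contradicts [w1];
    if it is not in [U], [w2] is contradicted. *)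
Lemma helly3 S T U (p z w1 w2 : W) :
    para S (p^-1 * w1) -> para T (z^-1 * w1) ->
    para S (p^-1 * w2) -> para U (z^-1 * w2) ->
  exists2 y, para S (p^-1 * y) & para (T :&: U)%SET (z^-1 * y).
Proof.
move=> pw1 zw1 pw2 zw2; apply: contrapT => npz.
have [|x [c [zx cTU cP]]] := @gate (T :&: U)%SET S z p.
  by move=> y zy py; apply: npz; exists y.
move: zx; rewrite paraI => /andP[Tx Ux].
have nside (R : {set V}) w : c \notin R -> para R (z^-1 * x) -> para R (z^-1 * w) ->
    para S (p^-1 * w) -> False.
  move=> cR zx zw /cP; rewrite -[w](mulVKg x) (side_para _ _ cR) ?side_base //.
  by rewrite -(para_trans (y := z)) // para_sym.
move: cTU; rewrite inE negb_and => /orP[cT|cU]; first exact: nside zw1 pw1.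
exact: nside zw2 pw2.
Qed.

(** The base coset [r<R>] varies in the induction so that it can absorb the first coset of the list;
    by [helly3] their intersection still meets all the others. *)
Lemma helly (r : W) (R : {set V}) (L : seq (W * {set V})) :
    {in L, forall P, exists2 z, para R (r^-1 * z) & para P.2 (P.1^-1 * z)} ->
    {in L &, forall P Q, exists2 z, para P.2 (P.1^-1 * z) & para Q.2 (Q.1^-1 * z)} ->
  exists2 z, para R (r^-1 * z) & {in L, forall P, para P.2 (P.1^-1 * z)}.
Proof.
elim: L r R => [|P L IHL] r R RL LL.
  by exists r; rewrite ?mulVg ?para1.
have [x rx Px] := RL P (mem_head _ _).
have [||z xz zL] := IHL x (R :&: P.2)%SET.
- move=> Q QL; have QL' : Q \in P :: L by rewrite inE QL orbT.
  have [w1 rw1 Qw1] := RL _ QL'; have [w2 Pw2 Qw2] := LL _ _ (mem_head _ _) QL'.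
  have [||||y Qy xy] := @helly3 Q.2 R P.2 Q.1 x w1 w2 => //.
  + by rewrite -(para_trans (y := r)) // para_sym.
  + by rewrite -(para_trans (y := P.1)) // para_sym.
  + by exists y.
- by move=> Q Q' QL Q'L; apply: LL; rewrite inE ?QL ?Q'L orbT.
move: xz; rewrite paraI => /andP[Rz Pz].
exists z; first by rewrite -(para_trans (y := x)).
move=> Q; rewrite inE => /predU1P[->|/zL //].
by rewrite -(para_trans (y := x)).
Qed.

End Sides.

(** * Edges and squares *)

Section Cardinality.
Context {T : eqType}.
Implicit Types (A : set T) (s : seq T).

Lemma card_uniq s : uniq s -> [set` s] #= `I_(size s).
Proof.
case: s => [|x s] us; first by rewrite II0 set_nil.
have -> : [set` x :: s] = nth x (x :: s) @` `I_(size (x :: s)).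
  apply/seteqP; split=> [y /= ys|_ [i /= ilt <-]]; last exact: mem_nth.
  by exists (index y (x :: s)); [rewrite -index_mem in ys | rewrite nth_index].
apply: inj_card_eq => i j; rewrite !inE => ilt jlt /eqP.
by rewrite nth_uniq // => /eqP.
Qed.

Lemma uniq_size_le A n s :
  A #= `I_n -> uniq s -> (forall x, x \in s -> A x) -> (size s <= n)%N.
Proof.
move=> An us sA; rewrite -card_le_II -(card_le_eqr An) -(card_le_eql (card_uniq us)).
exact: subset_card_le.
Qed.

Lemma size_ge_cover A n s :
  A #= `I_n -> (forall x, A x -> x \in s) -> (n <= size s)%N.
Proof.
move=> An sA; apply: leq_trans (size_undup s).
rewrite -card_le_II -(card_le_eql An) -(card_le_eqr (card_uniq (undup_uniq s))).
by apply: subset_card_le => x /sA; rewrite /= mem_undup.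
Qed.

End Cardinality.

Section Davis.
Context {V : finType} {adj : rel V}.
Hypotheses (adj_sym : symmetric adj) (adj_irr : irreflexive adj).
Local Notation W := (racg adj).
Local Notation X := (davis adj).
Local Notation gen := (@racg_gen V adj).
Implicit Types (S T : {set V}) (a b c : V) (s t : seq V) (g h x y z k v : W).

Lemma adj_neq a b : adj a b -> a != b.
Proof. by apply: contraTneq => ->; rewrite adj_irr. Qed.

Lemma para_set1 a g : para [set a]%SET g -> g = 1 \/ g = gen a.
Proof.
move: g; apply: para_ind => [|c g]; first by left.
rewrite inE => /eqP -> _ [] ->; first by right; rewrite mulg1.
by left; rewrite genK.
Qed.

Lemma para_set2 a b g : adj a b -> para [set a; b]%SET g ->
  g \in [:: 1; gen a; gen b; gen a * gen b].
Proof.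
move=> ab; move: g; apply: para_ind => [|c g]; first by rewrite inE eqxx.
rewrite !inE => /orP[] /eqP -> _ /or4P[] /eqP ->;
  rewrite ?mulg1 ?mulgA ?genK ?mul1g -?(gen_comm ab) ?eqxx ?orbT //.
by rewrite -mulgA genK mulg1 eqxx orbT.
Qed.

Definition coset x T : set W := [set y | para T (x^-1 * y)].

Lemma coset_refl x T : coset x T x.
Proof. by rewrite /coset /= mulVg para1. Qed.

Lemma coset_eq x y T : coset x T y -> coset x T = coset y T.
Proof.
by move=> xy; apply/funext => z; rewrite /coset /= (para_trans z xy).
Qed.

Lemma coset_gen x y c T : c \in T -> coset x T (y * gen c) <-> coset x T y.
Proof. by move=> cT; rewrite /coset /= mulgA paraMr // para_gen. Qed.

Lemma coset_genI x c T : coset x T (x * gen c) -> c \in T.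
Proof. by rewrite /coset /= mulKg para_genE. Qed.

Lemma cubeP (C : set W) :
  @cube X C <-> exists x T, clique adj T /\ C = coset x T.
Proof.
have cosE x T : lcoset x (generated (gen @` [set` T])) = coset x T.
  rewrite generatedE; apply/seteqP; split=> [_ [y yT <-]|y xy].
    by rewrite /coset /= mulKg.
  by exists (x^-1 * y); rewrite ?mulVKg.
by split=> -[x [T [Tc ->]]]; exists x, T; rewrite cosE.
Qed.

Definition ed x a : set W := [set x; x * gen a].

Lemma edC x a : ed (x * gen a) a = ed x a.
Proof. by rewrite /ed -mulgA genK mulg1 setUC. Qed.

Lemma edE x a v : ed x a v -> ed x a = ed v a.
Proof. by case=> -> //; rewrite edC. Qed.

Lemma uniq_corners1 x a : uniq [:: x; x * gen a].
Proof.
rewrite /= inE andbT; apply/eqP => /(congr1 (parity a)).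
by rewrite parityM parity_gen eqxx; case: parity.
Qed.

Lemma uniq_corners x a b : a != b ->
  uniq [:: x; x * gen a; x * gen b; x * gen a * gen b].
Proof.
(* The parities of [a] and [b] distinguish the four corners. *)
move=> ab; apply: (@map_uniq _ _ (fun g => (parity a g, parity b g))).
rewrite /= !parityM !parity_gen !eqxx (negbTE ab) eq_sym (negbTE ab) !inE !xpair_eqE.
by case: (parity a x); case: (parity b x).
Qed.

Lemma edgeP (e : set W) : @edge X e <-> exists x a, e = ed x a.
Proof.
split=> [[/cubeP[x [T [_ ->]]] e2]|[x [a ->]]]; last first.
  split.
    apply/cubeP; exists x, [set a]%SET; split.
      by move=> b c; rewrite !inE => /eqP -> /eqP ->; rewrite eqxx.
    apply/seteqP; split=> [_ [] ->|y]; rewrite /coset /= ?mulKg ?para_genE ?inE //.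
      exact: coset_refl.
    by case/para_set1 => /(canRL (mulVKg x)) ->; [left; rewrite mulg1|right].
  have -> : ed x a = [set` [:: x; x * gen a]].
    apply/seteqP; split=> y /=; rewrite !inE.
      by case=> ->; rewrite eqxx ?orbT.
    by case/orP => /eqP ->; [left | right].
  exact: (card_uniq (uniq_corners1 x a)).
have [T0|[a aT]] := set_0Vmem T.
  suff /(size_ge_cover e2) : forall y, coset x T y -> y \in [:: x] by [].
  move=> y; rewrite T0 /coset /= inE => /para0 /(canRL (mulVKg x)) ->.
  by rewrite mulg1.
have xa : coset x T (x * gen a) by apply/coset_gen => //; exact: coset_refl.
exists x, a; apply/seteqP; split=> [y xy|_ [] -> //]; last exact: coset_refl.
apply: contrapT => /not_orP[yx yxa].
have us : uniq [:: y; x; x * gen a].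
  rewrite cons_uniq uniq_corners1 andbT !inE negb_or.
  by apply/andP; split; apply/eqP.
suff /(uniq_size_le e2 us) : forall z, z \in [:: y; x; x * gen a] -> coset x T z by [].
by move=> z; rewrite !inE => /or3P[] /eqP -> //; exact: coset_refl.
Qed.

Lemma edge_ed x a : @edge X (ed x a).
Proof. by apply/edgeP; exists x, a. Qed.

Lemma ed_inj x y a b : ed x a = ed y b -> a = b /\ ed x a y.
Proof.
move=> xy; have yb : ed y b (y * gen b) by right.
split; last by rewrite xy; left.
have : ed x a y by rewrite xy; left.
move: yb; rewrite -xy => -[] /= yb [] /= ya; rewrite ya -?mulgA in yb.
- by move: yb => /(canRL (mulKg x)); rewrite mulVg => /gen_neq1.
- move: yb; rewrite -{2}[x]mulg1 => /mulgI /(canRL (mulKg _)).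
  by rewrite mulg1 invg_gen => /gen_inj.
- by move/mulgI/gen_inj: yb.
- by move: yb => /mulgI /(canRL (mulKg _)); rewrite mulVg => /gen_neq1.
Qed.

Lemma square_corners x a b (s : set W) : @square X s -> a != b ->
    s x -> s (x * gen a) -> s (x * gen b) -> s (x * gen a * gen b) ->
  forall y, s y -> y \in [:: x; x * gen a; x * gen b; x * gen a * gen b].
Proof.
case=> _ s4 ab s1 s2 s3 s'4 y sy; apply/negPn/negP => ys.
have us : uniq (y :: [:: x; x * gen a; x * gen b; x * gen a * gen b]).
  by rewrite cons_uniq ys uniq_corners.
suff /(uniq_size_le s4 us) : forall z,
  z \in y :: [:: x; x * gen a; x * gen b; x * gen a * gen b] -> s z by [].
by move=> z; rewrite !inE => /orP[/eqP -> //|/or4P[] /eqP ->].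
Qed.

Lemma clique2 a b : adj a b -> clique adj [set a; b]%SET.
Proof.
move=> ab c d; rewrite !inE => /orP[] /eqP -> /orP[] /eqP ->; rewrite ?eqxx //.
by rewrite adj_sym.
Qed.

Lemma squareP x a b : adj a b -> @square X (coset x [set a; b]%SET).
Proof.
move=> ab; split.
  by apply/cubeP; exists x, [set a; b]%SET; split=> //; exact: clique2.
have aT : a \in [set a; b]%SET by rewrite !inE eqxx.
have bT : b \in [set a; b]%SET by rewrite !inE eqxx orbT.
have -> : coset x [set a; b]%SET = [set` [:: x; x * gen a; x * gen b; x * gen a * gen b]].
  apply/seteqP; split=> y /=; last first.
    rewrite !inE => /or4P[] /eqP ->; rewrite ?coset_gen //; exact: coset_refl.
  move=> /(para_set2 ab) /(map_f (fun g => x * g)).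
  by rewrite mulVKg /= mulg1 mulgA.
exact: (card_uniq (uniq_corners x (adj_neq ab))).
Qed.

Lemma oppositeP (e f : set W) : @opposite X e f <->
  exists x a b, [/\ adj a b, e = ed x a & f = ed (x * gen b) a].
Proof.
split=> [[/edgeP[x [a ->]] /edgeP[y [b ->]] ef0 [s [cs s4] [xs ys]]]|]; last first.
  move=> [x [a [b [ab -> ->]]]]; split; try exact: edge_ed.
    rewrite -subset0 => z [] zx zb; have := uniq_corners x (adj_neq ab).
    rewrite /= !inE !negb_or => /and4P[/and3P[_ xb xab] /andP[xab' xaab] _ _].
    move: zb; rewrite /ed -mulgA -(gen_comm ab) mulgA.
    by case: zx => -> [] /eqP; apply/negP.
  exists (coset x [set a; b]%SET); first exact: squareP.
  by split=> _ [] ->; rewrite ?coset_gen ?inE ?eqxx ?orbT //; exact: coset_refl.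
have disj z : ed x a z -> ed y b z -> False.
  by move=> xz yz; have : (ed x a `&` ed y b) z by []; rewrite ef0.
have [x' [T [Tc sE]]] := (cubeP s).1 cs.
have sx : s x by apply: xs; left.
have sT : s = coset x T by rewrite sE; apply: coset_eq; rewrite -sE.
have aT : a \in T by apply: (@coset_genI x); rewrite -sT; apply: xs; right.
have bT : b \in T.
  apply: (@coset_genI y); have <- : s = coset y T; last by apply: ys; right.
  by rewrite sT; apply: coset_eq; rewrite -sT; apply: ys; left.
(* If [T] were [{a}], the coset [s] would be the edge [ed x a] and meet the second edge. Another
   letter [c] of [T] already yields four corners, which exhaust [s]. *)
have [T1|] := pselect (forall c, c \in T -> c = a).
  have : s y by apply: ys; left.
  have : ed x a y -> False by move=> xy; apply: (disj y) => //; left.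
  rewrite sT /coset /= => nxy xy; case: nxy.
  suff : para [set a]%SET (x^-1 * y).
    by case/para_set1 => /(canRL (mulVKg x)) ->; [left; rewrite mulg1|right].
  case/paraP: xy => t /allP tT ->; apply: para_word; apply/allP => c /tT /T1 ->.
  by rewrite /= inE.
move=> /existsNP[c] /not_implyP[cT /eqP ca].
have ac : adj a c by apply: Tc; rewrite // eq_sym.
exists x, a, c; split=> //.
have sxa : s (x * gen a) by apply: xs; right.
have gens d z : d \in T -> s z -> s (z * gen d) by move=> dT; rewrite sT coset_gen.
have corners := @square_corners x a c s (conj cs s4) (adj_neq ac)
  sx sxa (gens _ _ cT sx) (gens _ _ cT sxa).
have far z : ed y b z -> ed (x * gen c) a z.
  move=> yz; have := corners z (ys _ yz); rewrite !inE => /or4P[] /eqP zE.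
  - by case: (disj z) => //; left.
  - by case: (disj z) => //; right.
  - by left.
  - by right; rewrite zE -!mulgA (gen_comm ac).
have y1 : ed (x * gen c) a y by apply: far; left.
have y2 : ed y a (y * gen b) by rewrite -(edE y1); apply: far; right.
rewrite (edE y1); congr ed; case: y2 => [/esym y2|/mulgI/gen_inj//].
by have := uniq_corners1 y b; rewrite /= inE {1}y2 eqxx.
Qed.

End Davis.

(** * Hyperplanes and contacts *)

Section Hyperplanes.
Context {V : finType} {adj : rel V}.
Hypotheses (adj_sym : symmetric adj) (adj_irr : irreflexive adj).
Local Notation W := (racg adj).
Local Notation X := (davis adj).
Local Notation gen := (@racg_gen V adj).
Local Notation st := (star adj).
Implicit Types (S T : {set V}) (a b c l m : V) (s t : seq V) (g h x y z k v : W).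
Implicit Types (u w : hyperplane X).

Lemma para_shift T g k x : para T k -> para T ((g * k)^-1 * x) = para T (g^-1 * x).
Proof. by move=> kT; rewrite invgM -mulgA paraMl // paraV. Qed.

Lemma ed_para x a y : ed x a y -> para (st a) (x^-1 * y).
Proof.
by case=> ->; rewrite ?mulVg ?para1 // mulKg para_gen // star_refl.
Qed.

(* The set of all ways of writing an edge parallel to [e] as [{y, y * a}]; an
   invariant of parallelism. *)
Definition parallel_class (e : set W) : set (V * W) :=
  [set p | exists x, e = ed x p.1 /\ para (st p.1) (x^-1 * p.2)].

Lemma parallel_class_ed x a y b :
  parallel_class (ed x a) (b, y) <-> a = b /\ para (st a) (x^-1 * y).
Proof.
split=> [[z [/ed_inj[/= -> /ed_para xz]]]|[<- xy]]; last by exists x.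
by rewrite (para_trans _ xz).
Qed.

Lemma parallel_class_inv (e f : set W) :
    clos_refl_sym_trans _ (@opposite X) e f ->
  (@edge X e <-> @edge X f) /\ parallel_class e = parallel_class f.
Proof.
elim=> // [{}e {}f ef|{}e {}f _ [fe ->] //|{}e {}f g _ [ef ->] _ [fg ->]].
- have [ee ff _ _] := ef; split=> //; move: ef => /(oppositeP adj_sym adj_irr).
  move=> [x [a [c [ac -> ->]]]]; apply/seteqP.
  have xc : para (st a) (x^-1 * (x * gen c)) by rewrite mulKg para_genE inE ac orbT.
  split=> -[d z] /parallel_class_ed[ad xz]; apply/parallel_class_ed; split=> //.
    by rewrite (para_trans _ xc).
  by rewrite -(para_trans _ xc).
- by split=> //; rewrite fe.
- by split=> //; rewrite ef fg.
Qed.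

(** One direction reads off the invariant [parallel_class]. For the other, go along a word for [k]:
    the letter [a] keeps the edge and a letter adjacent to [a] moves it across a square. *)
Lemma parallelP x a (f : set W) :
  clos_refl_sym_trans _ (@opposite X) (ed x a) f <->
  exists2 k, para (st a) k & f = ed (x * k) a.
Proof.
split=> [/parallel_class_inv[[/(_ (edge_ed x a)) + _]]|[k + ->]].
  case/edgeP => y [b ->] xyE.
  have /parallel_class_ed[-> xy] : parallel_class (ed x a) (b, y).
    by rewrite xyE; apply/parallel_class_ed; rewrite mulVg para1.
  by exists (x^-1 * y); rewrite ?mulVKg.
move: k; apply: para_ind_r => [|c k]; first by rewrite mulg1; exact: rst_refl.
rewrite inE mulgA => /predU1P[->|ac] _ xk; first by rewrite edC.
by apply: rst_trans xk _; apply/rst_step/oppositeP => //; exists (x * k), a, c.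
Qed.

Fact hyp_is_hyperplane a g :
  is_hyperplane (X := X) [set f | exists2 k, para (st a) k & f = ed (g * k) a].
Proof.
exists (ed g a); first exact: edge_ed.
by apply/seteqP; split=> f; rewrite /= parallelP.
Qed.

Definition hyp a g : hyperplane X := Hyperplane (hyp_is_hyperplane a g).

Lemma hypP u : exists a g, u = hyp a g.
Proof.
case: u => u uP; have [_ /edgeP[g [a ->]] uE] := uP.
exists a, g; apply: hyperplane_inj; rewrite /= uE.
by apply/seteqP; split=> f; rewrite /= parallelP.
Qed.

Lemma hyp_ed a g x b : dual_edges (hyp a g) (ed x b) <-> a = b /\ para (st a) (g^-1 * x).
Proof.
split=> [[k ak /esym/ed_inj[<- /ed_para gx]]|[<- gx]].
  by split=> //; rewrite -(para_shift _ _ ak).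
by exists (g^-1 * x); rewrite ?mulVKg.
Qed.

Lemma hyp_eq a g b h : hyp a g = hyp b h <-> a = b /\ para (st a) (g^-1 * h).
Proof.
split=> [ab|[<- gh]].
  by apply/hyp_ed; rewrite ab; apply/hyp_ed; rewrite mulVg para1.
apply: hyperplane_inj; apply/seteqP; split=> _ [k ak ->].
  by exists (h^-1 * (g * k)); rewrite ?mulVKg // mulgA paraMr // para_sym.
by exists (g^-1 * (h * k)); rewrite ?mulVKg // mulgA paraMr.
Qed.

Lemma hyperplanes_atP v u : @hyperplanes_at X v u <-> exists a, u = hyp a v.
Proof.
split=> [[e ue ev]|[a ->]]; last first.
  by exists (ed v a); [apply/hyp_ed; rewrite mulVg para1 | left].
have [a [g uE]] := hypP u; move: ue; rewrite uE => -[k ak eE].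
exists a; apply/hyp_eq; split=> //.
by move: ev; rewrite eE => /ed_para; rewrite para_shift.
Qed.

Lemma hyp_at a g v : @hyperplanes_at X v (hyp a g) <-> para (st a) (g^-1 * v).
Proof.
by split=> [/hyperplanes_atP[b /hyp_eq[]]//|gv]; apply/hyperplanes_atP; exists a; apply/hyp_eq.
Qed.

Lemma same_side_side a g x y : same_side (hyp a g) x y -> side a g x = side a g y.
Proof.
elim=> // [{}x {}y [/edgeP[z [c zE]]]|{}x {}y z _ -> _ -> //].
have xz : ed z c x by rewrite -zE; left.
have yz : ed z c y by rewrite -zE; right.
rewrite zE (edE xz) in yz *; case: yz => -> // nxc.
rewrite (side_gen adj_sym); case: (c =P a) => [ca|]; last by rewrite /= addbF.
case gx: (para _ _); last by rewrite addbF.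
by case: nxc; rewrite ca; apply/hyp_ed.
Qed.

(** A path labelled by [T] stays in the coset, and an edge of it dual to the hyperplane would change
    [side]. With [same_side_side], this turns the conclusion of [gate] into a separation of
    halfspaces. *)
Lemma coset_same_side a g T x y :
    (forall z, para T (x^-1 * z) -> side a g z = side a g x) ->
  para T (x^-1 * y) -> same_side (hyp a g) x y.
Proof.
move=> sT; rewrite -{2}(mulVKg x y); move: (x^-1 * y).
apply: para_ind_r => [|c k cT kT xk]; first by rewrite mulg1; exact: rt_refl.
apply: rt_trans xk _; apply: rt_step; rewrite mulgA; split; first exact: edge_ed.
move/hyp_ed => [ac gxk]; have := sT (x * k * gen c).
rewrite -mulgA mulKg paraM ?para_gen // mulgA (side_gen adj_sym) (sT (x * k)) ?mulKg //.
by rewrite ac eqxx -ac gxk addbT => /(_ isT); case: side.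
Qed.

Lemma same_side_sym u x y : same_side u x y -> same_side u y x.
Proof.
elim=> [{}x {}y xy|{}x|{}x {}y z _ yx _ zy]; last exact: rt_trans zy yx.
  by apply: rt_step; rewrite setUC.
exact: rt_refl.
Qed.

Lemma same_side_eq u x y : same_side u x y -> same_side u x = same_side u y.
Proof.
move=> xy; apply/seteqP; split=> z; last exact: rt_trans.
exact/rt_trans/same_side_sym.
Qed.

(** A common vertex of the carriers would lie in both halfspaces of a separation. If the carriers
    are disjoint, [gate] applied to their cosets yields a hyperplane that separates them. *)
Lemma contactP u w : @adjacent (contact_graph X) u w <->
  u <> w /\ exists v : W, @hyperplanes_at X v u /\ @hyperplanes_at X v w.
Proof.
split=> [[uw nsep]|[uw [v [[e ue ev] [f wf fv]]]]]; split=> //; last first.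
  move=> [h [_ _ [_ [_ [[x ->] [y ->] xy uA wB]]]]]; apply: xy.
  have xv := uA _ ue _ ev; have yv := wB _ wf _ fv.
  by rewrite (same_side_eq xv) (same_side_eq yv).
apply: contrapT => nv; apply: nsep.
have [a [g uE]] := hypP u; have [b [h wE]] := hypP w; subst u w.
have [|x [c [gx ca cP]]] := @gate _ _ adj_sym (st a) (st b) g h.
  by move=> z gz hz; apply: nv; exists z; split; apply/hyp_at.
have side_x z : para (st a) (x^-1 * z) -> side c x z = false.
  by move=> xz; rewrite -(mulVKg x z) (side_para adj_sym _ _ ca) // (side_base adj_sym).
have hh : para (st b) (h^-1 * h) by rewrite mulVg para1.
exists (hyp c x); split.
- by move=> /hyp_eq[ca']; rewrite ca' star_refl in ca.
- move=> /hyp_eq[cb /paraV]; rewrite invgM invgK cb => hx.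
  by have := cP _ hx; rewrite (side_base adj_sym).
exists (same_side (hyp c x) x), (same_side (hyp c x) h); split.
- by exists x.
- by exists h.
- move=> xh; have : same_side (hyp c x) x h by rewrite xh; exact: rt_refl.
  by move=> /same_side_side; rewrite (side_base adj_sym) (cP _ hh).
- move=> _ [k ak ->] z /ed_para gkz; apply: (coset_same_side (T := st a)) => [y xy|].
    by rewrite (side_base adj_sym) side_x.
  rewrite -(para_trans (y := g)); last by rewrite para_sym.
  by rewrite -(para_shift _ _ ak).
- move=> _ [k bk ->] z /ed_para hkz; apply: (coset_same_side (T := st b)) => [y hy|].
    by rewrite !cP.
  by rewrite -(para_shift _ _ bk).
Qed.

End Hyperplanes.

(** * The homomorphism rho *)

Section Rho.
Context {V : finType} {adj : rel V}.
Hypotheses (adj_sym : symmetric adj) (adj_irr : irreflexive adj).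
Local Notation W := (racg adj).
Local Notation X := (davis adj).
Local Notation gen := (@racg_gen V adj).
Local Notation st := (star adj).
Local Notation hyp := (hyp adj_sym adj_irr).
Local Notation hypP := (hypP adj_sym adj_irr).
Local Notation at_ := (@hyperplanes_at X).
Implicit Types (S T : {set V}) (a b c l m : V) (s t : seq V) (g h x y z k v : W).
Implicit Types (u w : hyperplane X) (phi psi : graph_aut (contact_graph X)).

(** A generator adjacent to all others is central, so it generates a direct factor of order two,
    complemented by the subgroup of the other generators. *)
Lemma no_factor_no_cone :
  no_finite_direct_factor W -> forall a, exists b, b \notin st a.
Proof.
move=> nf a; apply: contrapT => /forallNP sta.
have {}sta b : b \in st a by apply/negPn/negP/sta.
have ga g : gen a * g = g * gen a.
  apply: para_star_comm; have [s ->] := wordE g; apply: para_word.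
  by apply/allP => b _; exact: sta.
have := nf [set 1; gen a] [set g | para [set~ a]%SET g].
move=> /(_ _ (finite_set2 _ _)) H; suff /H : direct_decomposition [set 1; gen a]
    [set g | para [set~ a]%SET g].
  by move/seteqP => [/(_ (gen a)) /(_ (or_intror erefl)) /gen_neq1].
split.
- split; first by left.
    by move=> x y [] -> [] ->; rewrite ?mul1g ?mulg1 ?genK; [left|right|right|left].
  by move=> x [] ->; rewrite ?invg1 ?invg_gen; [left|right].
- split; [exact: para1 | move=> x y; exact: paraM | move=> x; exact: paraV].
- by move=> h k [] -> _; rewrite ?mul1g ?mulg1.
- apply/seteqP; split=> [x [[] -> //]|_ ->]; last by split; [left | exact: para1].
  by rewrite /= para_genE !inE eqxx.
apply: (@racg_ind V adj) => [|c g [h [k [hH kK ->]]]].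
  by exists 1, 1; split; [left | exact: para1 | rewrite mulg1].
have [->|ca] := eqVneq c a.
  exists (gen a * h), k; split=> //; last by rewrite mulgA.
  by case: hH => ->; rewrite ?mulg1 ?genK; [right|left].
exists h, (gen c * k); split=> //; first by apply: paraM => //; rewrite para_genE !inE.
by case: hH => ->; rewrite ?mul1g // !mulgA -ga.
Qed.

Hypothesis no_cone : forall a, exists b, b \notin st a.

(** By [gate], some edge [{v, v c}] is dual to a hyperplane with [h<T>] on its far side. For [a]
    outside [st c], the letter [c] is not in [st a], so [v<st a>] stays on the near side. *)
Lemma coset_star_disjoint v h T : ~ para T (h^-1 * v) ->
  exists a, forall z, para (st a) (v^-1 * z) -> para T (h^-1 * z) -> False.
Proof.
move=> hv; have [|x [c [/para0 vx _ cP]]] := @gate _ _ adj_sym finset.set0 T v h.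
  by move=> z /para0 /(canRL (mulVKg _)); rewrite mulg1 => ->.
move: vx => /(canRL (mulVKg _)); rewrite mulg1 => xv; subst x.
have [a ac] := no_cone c; exists a => z vz /cP.
rewrite -(mulVKg v z) (side_para adj_sym _ _ _ vz) ?(side_base adj_sym) //.
by rewrite star_sym.
Qed.

Lemma hyperplanes_at_inj v h : at_ v = at_ h -> v = h.
Proof.
move=> vh; apply/esym.
have [/para0 /(canRL (mulVKg _))|] := pselect (para finset.set0 (h^-1 * v)).
  by rewrite mulg1.
move=> /coset_star_disjoint[a /(_ h)]; rewrite mulVg para1 => /(_ _ isT)[].
by apply/(hyp_at adj_sym adj_irr); rewrite -vh; apply/hyp_at; rewrite mulVg para1.
Qed.

Definition meet u w := exists v : W, at_ v u /\ at_ v w.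

Lemma meetP u w : meet u w <-> u = w \/ @adjacent (contact_graph X) u w.
Proof.
split=> [uw|[<-|/(contactP adj_sym adj_irr)[]//]].
  by have [|uw'] := pselect (u = w); [left | right; apply/contactP].
by have [a [g ->]] := hypP u; exists g; split; apply/hyp_at; rewrite mulVg para1.
Qed.

Lemma aut_inj phi : injective phi.
Proof. exact: can_inj (sym_funK phi). Qed.

Lemma aut_meet phi u w : meet (phi u) (phi w) <-> meet u w.
Proof.
have /is_graph_autP phiP := graph_autP phi.
rewrite !meetP -phiP; split=> -[]; try by right.
  by move/aut_inj; left.
by move=> ->; left.
Qed.

(** Maximality of the clique [at_ v]: a carrier that misses [v] is disjoint from some [v<st a>]. *)
Lemma meet_at v u : (forall a, meet (hyp a v) u) -> at_ v u.
Proof.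
have [b [h ->]] := hypP u => vu; apply/hyp_at; apply: contrapT.
move=> /coset_star_disjoint[a av]; have [z [vz hz]] := vu a.
by apply: (av z); apply/(hyp_at adj_sym adj_irr).
Qed.

Lemma helly_hyperplanes (F : V -> hyperplane X) :
  (forall a b, meet (F a) (F b)) -> exists v : W, forall a, at_ v (F a).
Proof.
move=> FF.
have /choice[p pE] : forall a, exists p : V * W, F a = hyp p.1 p.2.
  by move=> a; have [l [g ->]] := hypP (F a); exists (l, g).
have [||z _ zP] := 
  @helly _ _ adj_sym 1 [set: V]%SET [seq ((p a).2, st (p a).1) | a <- enum V].
- by move=> _ /mapP[a _ ->]; exists (p a).2; rewrite ?paraT //= mulVg para1.
- move=> _ _ /mapP[a _ ->] /mapP[b _ ->]; have [z []] := FF a b.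
  by rewrite !pE => /hyp_at za /hyp_at zb; exists z.
by exists z => a; rewrite pE; apply/hyp_at/(zP (_, _))/map_f; rewrite mem_enum.
Qed.

(** The image of [at_ v] meets pairwise, so the Helly property places it inside some [at_ v']. The
    preimage of [at_ v'] meets all of [at_ v], and maximality of [at_ v] gives equality. *)
Lemma aut_hyperplanes_at phi v : exists v' : W, at_ v' = phi @` at_ v.
Proof.
have meets a b : meet (hyp a v) (hyp b v).
  by exists v; split; apply/hyp_at; rewrite mulVg para1.
have [|v' v'P] := @helly_hyperplanes (fun a => phi (hyp a v)).
  by move=> a b; apply/aut_meet.
exists v'; apply/seteqP; split; last first.
  by move=> _ [u /hyperplanes_atP-/(_ adj_sym adj_irr)[a ->] <-]; exact: v'P.
move=> u v'u.
exists (sym_inv phi u); last exact: sym_invK.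
apply: meet_at => a; apply/(aut_meet phi); rewrite sym_invK.
by exists v'.
Qed.

Definition rho_fun phi v : W := sval (cid (aut_hyperplanes_at phi v)).

Lemma rho_funP phi v : at_ (rho_fun phi v) = phi @` at_ v.
Proof. exact: svalP (cid (aut_hyperplanes_at phi v)). Qed.

Lemma rho_funM phi psi v : rho_fun (phi * psi) v = rho_fun phi (rho_fun psi v).
Proof. by apply: hyperplanes_at_inj; rewrite !rho_funP image_comp. Qed.

Lemma rho_fun1 v : rho_fun 1 v = v.
Proof. by apply: hyperplanes_at_inj; rewrite rho_funP image_id. Qed.

Fact rho_funK phi : cancel (rho_fun phi) (rho_fun phi^-1).
Proof. by move=> v; rewrite -rho_funM mulVg rho_fun1. Qed.

Fact rho_funVK phi : cancel (rho_fun phi^-1) (rho_fun phi).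
Proof. by move=> v; rewrite -rho_funM mulgV rho_fun1. Qed.

Definition rho phi : sym (vertex X) := Sym (rho_funK phi) (rho_funVK phi).

Fact rhoM : {morph rho : phi psi / phi * psi}.
Proof. by move=> phi psi; apply: symP; apply/funext => v; exact: rho_funM. Qed.

HB.instance Definition _ :=
  isMultiplicative.Build (graph_aut (contact_graph X)) (sym (vertex X))
    rho rhoM.

Lemma iota_at (s : cube_aut X) v : contact_iota s @` at_ v = at_ (s v).
Proof.
have sub (r : cube_aut X) x : contact_iota r @` at_ x `<=` at_ (r x).
  by move=> _ [u [e ue ev] <-]; exists (r @` e); [exists e | exists x].
apply/seteqP; split; first exact: sub.
move=> u su; exists (contact_iota s^-1 u); last exact: image_hyperplaneVK.
have := sub (s^-1) (s v); have -> : (s^-1)%g (s v) = v by exact: sym_funK.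
by apply; exists u.
Qed.

Lemma iota_inj : injective (@contact_iota X).
Proof.
move=> s t st; apply: val_inj; apply: symP; apply/funext => v.
by apply: hyperplanes_at_inj; rewrite -!iota_at st.
Qed.

(** A cone vertex [{v, v a}] of the link would span a square with [{v, v b}] for [b] outside [st a];
    the clique spanning that square contains [a] and [b]. *)
Lemma davis_not_extremal v : ~ @extremal X v.
Proof.
move=> [[e [ee ev]] eP]; have [x [a eE]] := (edgeP _).1 ee.
have [b ba] := no_cone a.
have vb : @edge X (ed v b) /\ ed v b v by split; [exact: edge_ed | left].
have vE : e = ed v a by rewrite eE; apply: edE; rewrite -eE.
have [] := eP (exist _ (ed v b) vb).
  move/(congr1 sval) => /=; rewrite vE => /ed_inj[ba' _].
  by rewrite ba' star_refl in ba.
move=> _ [q [cq _] [/= eq bq]].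
have [y [T [Tc qE]]] := (cubeP q).1 cq.
have qv : q = coset v T by rewrite qE; apply: coset_eq; rewrite -qE; apply: eq.
have aT : a \in T by apply: (@coset_genI _ _ v); rewrite -qv; apply: eq; rewrite vE; right.
have bT : b \in T by apply: (@coset_genI _ _ v); rewrite -qv; apply: bq; right.
case/negP: ba; rewrite inE; have [//|ba] := eqVneq b a.
by rewrite Tc // eq_sym.
Qed.

End Rho.

(** * Extremal vertices of hyperplanes *)

Section ExtremalHyperplanes.
Context {V : finType} {adj : rel V}.
Hypotheses (adj_sym : symmetric adj) (adj_irr : irreflexive adj).
Local Notation W := (racg adj).
Local Notation X := (davis adj).
Local Notation gen := (@racg_gen V adj).
Local Notation st := (star adj).
Local Notation hyp := (hyp adj_sym adj_irr).
Local Notation hypP := (hypP adj_sym adj_irr).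
Local Notation hyp_ed := (hyp_ed adj_sym adj_irr).
Implicit Types (S T : {set V}) (b c : V) (g h y z k : W).

Section FixedVertex.
Variables (a : V) (x : W).
Local Notation H := (hyperplane_complex (hyp a x)).
Implicit Types m : vertex H.

Lemma hyperplane_vertexP m : exists2 k, para (st a) k & sval m = ed (x * k) a.
Proof. exact: svalP m. Qed.

Lemma hyperplane_vertex_inj m m' : sval m = sval m' -> m = m'.
Proof.
by case: m m' => [e p] [f q] /= ef; subst f; congr exist; exact: Prop_irrelevance.
Qed.

Lemma hyperplane_vertex_ex k : para (st a) k -> exists m, sval m = ed (x * k) a.
Proof. by move=> ak; exists (exist (dual_edges (hyp a x)) _ (ex_intro2 _ _ k ak erefl)). Qed.

(* The cube of the hyperplane that is cut out by [x<T>], for [T] containing [a]. *)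
Definition hcube (T : {set V}) : set (vertex H) := [set m | sval m `<=` coset x T].

Lemma hcubeP (T : {set V}) m : a \in T ->
  hcube T m <-> exists2 y, coset x T y & sval m = ed y a.
Proof.
move=> aT; split=> [mT|[y xy mE]].
  have [k _ mE] := hyperplane_vertexP m; exists (x * k) => //.
  by apply: mT; rewrite mE; left.
by rewrite /hcube /= mE => z [] ->; rewrite ?coset_gen.
Qed.

Variable m0 : vertex H.
Hypothesis m0E : sval m0 = ed x a.

Lemma hcube0 T : a \in T -> hcube T m0.
Proof. by move=> aT; apply/hcubeP => //; exists x => //; exact: coset_refl. Qed.

Lemma hyperplane_cubeP (D : set (vertex H)) : D m0 ->
  @cube H D <-> exists T, [/\ clique adj T, a \in T & D = hcube T].
Proof.
move=> Dm; split=> [[_ [C /cubeP[y [T [Tc ->]]] DE]]|[T [Tc aT DE]]]; last first.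
  split; first by exists m0.
  by exists (coset x T) => //; apply/cubeP; exists x, T.
have yT z : ed x a z -> coset y T z.
  by move=> xz; move: Dm; rewrite DE /= => mT; apply: mT; rewrite m0E.
have yx : coset y T = coset x T by apply: coset_eq; apply: yT; left.
exists T; split=> //; last by rewrite DE yx.
by apply: (@coset_genI _ _ x); rewrite -yx; apply: yT; right.
Qed.

(** Each edge labelled [a] in the coset of [a |: S] has exactly one end in [x<S>], since [a]
    commutes with [S] and is not in it. This makes the edges and squares of the hyperplane
    recognisable by size. *)
Lemma card_hcube S : clique adj (a |: S) -> a \notin S -> hcube (a |: S) #= coset x S.
Proof.
move=> Sc aS; have aT : a \in a |: S by rewrite setU11.
have ac c : c \in S -> c \in st a.
  move=> cS; rewrite inE Sc ?orbT // ?inE ?cS ?orbT //.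
  by apply: contraNneq aS => ->.
have SE k : para (a |: S)%SET k -> exists2 k', para S k' & ed (x * k) a = ed (x * k') a.
  move: k; apply: para_ind_r => [|c k]; first by exists 1; rewrite ?para1.
  move=> cT _ [k' Sk' kE]; move: cT; rewrite mulgA in_setU1 => /predU1P[->|cS].
    by exists k'; rewrite ?edC.
  exists (k' * gen c); first by rewrite paraMr // para_gen.
  apply: edE; rewrite mulgA.
  have : ed (x * k) a (x * k') by rewrite kE; left.
  case=> ->; first by left.
  by right; rewrite -!mulgA (gen_star_comm (ac _ cS)).
have imE : sval @` hcube (a |: S)%SET = (fun y => ed y a) @` coset x S.
  apply/seteqP; split=> [_ [m /hcubeP[//|y xy mE] <-]|_ [y xy <-]].
    have [k' Sk' yE] := SE _ xy; exists (x * k'); first by rewrite /coset /= mulKg.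
    by rewrite -yE mulVKg mE.
  have Sst : para (st a) (x^-1 * y).
    case/paraP: xy => s /allP sS ->; apply: para_word; apply/allP => c /sS.
    exact: ac.
  have [m mE] := hyperplane_vertex_ex Sst; rewrite mulVKg in mE.
  exists m => //; apply/hcubeP => //; exists y => //.
  case/paraP: xy => s /allP sS yE; rewrite /coset /= yE; apply: para_word.
  by apply/allP => c /sS /= cS; rewrite in_setU1 cS orbT.
have inj1 : {in hcube (a |: S)%SET &, injective (fun m => sval m)}.
  by move=> m m' _ _; exact: hyperplane_vertex_inj.
have inj2 : {in coset x S &, injective (fun y => ed y a)}.
  move=> y z; rewrite !in_setE => xy xz /ed_inj[_ [] // zE].
  move: xz; rewrite zE (coset_eq xy) => /coset_genI aS'.
  by rewrite aS' in aS.
have := card_esym (inj_card_eq inj1); rewrite imE => /card_eq_trans -> //.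
exact: inj_card_eq.
Qed.

Lemma coset_set1 c : coset x [set c]%SET = ed x c.
Proof.
apply/seteqP; split=> y; rewrite /coset /=.
  by case/para_set1 => /(canRL (mulVKg x)) ->; [left; rewrite mulg1|right].
by case=> ->; rewrite ?mulVg ?para1 // mulKg para_genE inE.
Qed.

Lemma hyperplane_edgeP (D : set (vertex H)) : D m0 ->
  @edge H D <-> exists2 c, adj a c & D = hcube [set a; c]%SET.
Proof.
move=> Dm; split=> [[/(hyperplane_cubeP Dm)[T [Tc aT DE]] D2]|[c ac DE]].
  pose S := (T :\ a)%SET; have TE : T = (a |: S)%SET by rewrite finset.setD1K.
  have aS : a \notin S by rewrite !inE eqxx.
  have S2 : coset x S #= `I_2.
    apply: card_eq_trans (card_esym _) D2; rewrite DE TE; apply: card_hcube => //.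
    by rewrite -TE.
  have [|y [c xS]] := (@edgeP _ adj (coset x S)).1.
    split=> //; apply/cubeP; exists x, S; split=> // b d; rewrite !inE.
    by move=> /andP[_ bT] /andP[_ dT]; exact: Tc.
  have {}xS : coset x S = ed x c by rewrite xS; apply: edE; rewrite -xS; exact: coset_refl.
  have cS : c \in S by apply: (@coset_genI _ _ x); rewrite xS; right.
  have SE : S = [set c]%SET.
    apply/setP => d; rewrite inE; apply/idP/eqP => [dS|-> //].
    have : coset x S (x * gen d) by apply/coset_gen => //; exact: coset_refl.
    rewrite xS => -[|/mulgI/gen_inj //].
    by move/(canRL (mulKg x)); rewrite mulVg => /gen_neq1.
  exists c; last by rewrite DE TE SE.
  by move: cS; rewrite !inE => /andP[ca cT]; apply: Tc; rewrite // eq_sym.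
have acc : clique adj (a |: [set c])%SET by exact: clique2.
split; first by apply/(hyperplane_cubeP Dm); exists [set a; c]%SET; rewrite !inE eqxx.
rewrite DE; apply: card_eq_trans (card_hcube acc _) _.
  by rewrite inE (adj_neq adj_irr ac).
by rewrite coset_set1; exact: (edge_ed x c).2.
Qed.

Lemma hyperplane_square b c : adj a b -> adj a c -> adj b c ->
  @square H (hcube (a |: [set b; c])%SET).
Proof.
move=> ab ac bc; set T := (a |: _)%SET.
have Tc : clique adj T.
  move=> d e; rewrite !inE => /or3P[] /eqP -> /or3P[] /eqP ->; rewrite ?eqxx //;
    by rewrite adj_sym.
have aT : a \in T by rewrite !inE eqxx.
split; first by apply/(hyperplane_cubeP (hcube0 aT)); exists T.
apply: card_eq_trans (card_hcube Tc _) (squareP adj_sym adj_irr x bc).2.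
by rewrite !inE negb_or !(adj_neq adj_irr).
Qed.

(** The link of the midpoint of [{x, x a}] is the graph induced on the neighbours of [a]. A cone
    vertex is a neighbour [b] adjacent to all the other neighbours, which means that [st b] contains
    [st a]. *)
Lemma extremal_hyperplaneP : @extremal H m0 <-> exists b, a != b /\ st a \subset st b.
Proof.
have hc c : adj a c -> @edge H (hcube [set a; c]%SET) /\ hcube [set a; c]%SET m0.
  move=> ac; have m0c : hcube [set a; c]%SET m0 by apply: hcube0; rewrite !inE eqxx.
  by split=> //; apply/hyperplane_edgeP => //; exists c.
pose nd c ac : node (link m0) :=
  exist (fun e : set (vertex H) => edge e /\ e m0) _ (hc c ac).
have mc c : adj a c -> exists2 m, sval m = ed (x * gen c) a & hcube [set a; c]%SET m.
  move=> ac; have [|m mE] := @hyperplane_vertex_ex (gen c).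
    by rewrite para_genE inE ac orbT.
  exists m => //; apply/hcubeP; first by rewrite !inE eqxx.
  exists (x * gen c) => //; apply/coset_gen; last exact: coset_refl.
  by rewrite !inE eqxx orbT.
have hcube_gen c T : adj a c -> hcube [set a; c]%SET `<=` hcube T -> c \in T.
  move=> ac cT; have [m mE /cT mT] := mc c ac.
  by apply: (@coset_genI _ _ x); apply: mT; rewrite mE; left.
split=> [[[E [Ee Em]] EP]|[b [ab sab]]].
  have [b ab EE] := (hyperplane_edgeP Em).1 Ee.
  exists b; split; first exact: adj_neq adj_irr _ _ ab.
  apply/fintype.subsetP => c; rewrite !inE => /predU1P[->|ac].
    by rewrite adj_sym ab orbT.
  have [//|cb] := eqVneq c b.
  have [] := EP (nd c ac).
    move=> /(congr1 sval) /= cE; have : b \in [set a; c]%SET.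
      by apply: (hcube_gen b) => //; rewrite cE EE.
    by rewrite !inE [b == c]eq_sym (negbTE cb) orbF eq_sym (negbTE (adj_neq adj_irr ab)).
  move=> _ [s [sc _] [/= Es cs]].
  have [T [Tc aT sE]] := (hyperplane_cubeP (Es _ Em)).1 sc.
  apply: Tc; rewrite 1?eq_sym //; apply: hcube_gen => //; rewrite -?sE //.
  by rewrite -EE.
have ab' : adj a b.
  by have := fintype.subsetP sab _ (star_refl a); rewrite !inE (negbTE ab) adj_sym.
exists (nd b ab') => -[E [Ee Em]] Eb.
have [c ac EE] := (hyperplane_edgeP Em).1 Ee.
have cb : c != b.
  by apply/eqP => cb; apply: Eb; subst c E; congr exist; exact: Prop_irrelevance.
have bc : adj b c.
  by have /(fintype.subsetP sab) : c \in st a; rewrite !inE ?ac ?orbT // (negbTE cb).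
split; first by move=> bE; exact: Eb.
have mono S T : S \subset T -> hcube S `<=` hcube T.
  move=> ST m mS z /mS /paraP[s /allP sS zE]; rewrite /coset /= zE; apply: para_word.
  by apply/allP => d /sS /(fintype.subsetP ST).
exists (hcube (a |: [set b; c])%SET); first exact: hyperplane_square.
by split; rewrite /= ?EE; apply: mono; apply/fintype.subsetP => d;
  rewrite !inE => /orP[] ->; rewrite ?orbT.
Qed.

End FixedVertex.

Lemma extremal_hyperplane_vertexP :
  (exists (u : hyperplane X) (v : vertex (hyperplane_complex u)), extremal v) <->
  (exists a b : V, a != b /\ st a \subset st b).
Proof.
split=> [[u [v vext]]|[a [b ab]]].
  have [a [g uE]] := hypP u.
  have [k ak eE] : exists2 k, para (st a) k & sval v = ed (g * k) a.
    by move: (svalP v); move: (sval v) => e; rewrite uE.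
  (* Rebase the hyperplane at the edge whose midpoint is [v]. *)
  have {}uE : u = hyp a (g * k).
    by rewrite uE; apply/hyp_eq; rewrite mulKg.
  subst u; exists a; exact/(extremal_hyperplaneP eE).
have [|m mE] := @hyperplane_vertex_ex a 1 1; first exact: para1.
by exists (hyp a 1), m; apply/extremal_hyperplaneP; [rewrite mE mulg1 | exists b].
Qed.

End ExtremalHyperplanes.

(** * Exotic automorphisms of the contact graph *)

Lemma multiplicative1 (G H : groupType) (f : {multiplicative G -> H}) : f 1 = 1.
Proof. by apply: (mulgI (f 1)); rewrite -gmulfM !mulg1. Qed.

Lemma multiplicative_injP (G H : groupType) (f : {multiplicative G -> H}) :
  injective f <-> forall x, kernel f x -> x = 1.
Proof.
split=> [finj x fx|fker x y fxy]; first by apply: finj; rewrite multiplicative1.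
apply: (mulIg y^-1); rewrite mulgV; apply: fker.
by rewrite /kernel /= gmulfM fxy -gmulfM mulgV multiplicative1.
Qed.

Section ContactAutomorphisms.
Context {V : finType} {adj : rel V}.
Hypotheses (adj_sym : symmetric adj) (adj_irr : irreflexive adj).
Local Notation W := (racg adj).
Local Notation X := (davis adj).
Local Notation word := (racg_word adj).
Local Notation gen := (@racg_gen V adj).
Local Notation st := (star adj).
Local Notation hyp := (hyp adj_sym adj_irr).
Local Notation hypP := (hypP adj_sym adj_irr).
Local Notation at_ := (@hyperplanes_at X).
Local Notation side_gen := (side_gen adj_sym).
Implicit Types (S T : {set V}) (a b c l m : V) (s t : seq V) (g h x y z k v : W).
Implicit Types (u w : hyperplane X) (phi psi : graph_aut (contact_graph X)).

Lemma hyp_gen l v c : c \in st l -> hyp l (v * gen c) = hyp l v.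
Proof. by move=> cl; apply/esym/hyp_eq; rewrite mulKg para_genE. Qed.

(** The first condition makes the image of [hyp l v] independent of [v] in its coset of [<st l>].
    Contacts are preserved because hyperplanes sharing the vertex [v] go to hyperplanes sharing
    [p v]. *)
Lemma involution_aut (f : V -> W -> V) (p : W -> W) :
    (forall l v c, c \in st l ->
      hyp (f l (v * gen c)) (p (v * gen c)) = hyp (f l v) (p v)) ->
    (forall l v, hyp (f (f l v) (p v)) (p (p v)) = hyp l v) ->
  exists phi, forall l v, phi (hyp l v) = hyp (f l v) (p v).
Proof.
move=> fp fpK.
have /choice[r rE] : forall u, exists q : V * W, u = hyp q.1 q.2.
  by move=> u; have [l [v ->]] := hypP u; exists (l, v).
pose F u := hyp (f (r u).1 (r u).2) (p (r u).2).
have FE l v : F (hyp l v) = hyp (f l v) (p v).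
  rewrite /F; case: (r _) (rE (hyp l v)) => m y /= /hyp_eq[<-]{m}.
  rewrite -{2 3}(mulVKg v y); move: (v^-1 * y).
  apply: para_ind_r => [|c k cl _ <-]; first by rewrite mulg1.
  by rewrite mulgA fp.
have FK : involutive F.
  by move=> u; have [l [v ->]] := hypP u; rewrite !FE fpK.
have Fadj u w : @adjacent (contact_graph X) u w -> @adjacent (contact_graph X) (F u) (F w).
  move=> /(contactP adj_sym adj_irr)[uw [v [+ +]]].
  move=> /(hyperplanes_atP adj_sym adj_irr)[l uE].
  move=> /(hyperplanes_atP adj_sym adj_irr)[m wE].
  apply/(contactP adj_sym adj_irr); split; first by move/(can_inj FK).
  exists (p v); rewrite uE wE !FE.
  by split; apply/(hyperplanes_atP adj_sym adj_irr);
    [exists (f l v) | exists (f m v)].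
have Faut : (Sym FK FK : sym (node (contact_graph X))) \in @is_graph_aut (contact_graph X).
  by apply/is_graph_autP => u w; split=> /Fadj //=; rewrite !FK.
by exists (GraphAut Faut).
Qed.


(** * Infinitely many cosets of [<st a>], from an action on the half-line *)

Section DihedralAction.
Variables a c : V.
Hypothesis ca : c \notin st a.

(* On the half-line [nat], [c] exchanges [2k] and [2k + 1], while [a] fixes [0]
   and exchanges [2k + 1] and [2k + 2]. *)
Definition dihedral_act l n : nat :=
  if l == c then (if odd n then n.-1 else n.+1)
  else if l == a then (if odd n then n.+1 else n.-1) else n.

Lemma dihedral_actK l : involutive (dihedral_act l).
Proof.
rewrite /dihedral_act => n; case: (l == c); last case: (l == a) => //.
  by case: n => [|n] //=; case E: (odd n) => /=; rewrite ?E.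
by case: n => [|n] //=; case E: (odd n) => /=; rewrite ?E //; case: n E.
Qed.

Lemma dihedral_actC l m n : adj l m ->
  dihedral_act l (dihedral_act m n) = dihedral_act m (dihedral_act l n).
Proof.
move=> lm; rewrite /dihedral_act.
have nac : ~~ adj a c by apply/negP => ac; move: (negP ca); rewrite inE ac orbT.
have nlm d : l = d -> m = d -> False.
  by move=> ld md; move: lm; rewrite ld md adj_irr.
have [lc|_] := eqVneq l c; have [mc|_] := eqVneq m c => //;
  have [la|_] := eqVneq l a; have [ma|_] := eqVneq m a => //.
- by move: lm; rewrite lc ma adj_sym (negbTE nac).
- by move: lm; rewrite lc ma adj_sym (negbTE nac).
- by move: lm; rewrite la mc (negbTE nac).
- by move: lm; rewrite la mc (negbTE nac).
Qed.

(** The orbit map of [0]. All generators except [c] fix [0], so it is constant on the cosets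
    [g<st a>]; being onto, it attaches distinct indices to infinitely many of them. *)
Definition dihedral_orbit g : nat := foldr dihedral_act 0%N (repr g).

Lemma dihedral_orbit_word s : dihedral_orbit (word s) = foldr dihedral_act 0%N s.
Proof.
apply: (word_invariant (F := foldr dihedral_act 0%N)) (racg_repr _).
move=> _ _ [] {}s t l => [|m lm]; rewrite !foldr_cat /=; congr foldr.
  by rewrite dihedral_actK.
exact: dihedral_actC.
Qed.

Lemma dihedral_orbit_star g l : l != c -> dihedral_orbit (g * gen l) = dihedral_orbit g.
Proof.
move=> lc; have [s ->] := wordE g; rewrite -wordM !dihedral_orbit_word foldr_cat /=.
by congr foldr; rewrite /dihedral_act (negbTE lc); case: ifP.
Qed.

Lemma dihedral_orbit_para g k :
  para (st a) k -> dihedral_orbit (g * k) = dihedral_orbit g.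
Proof.
move: k; apply: para_ind_r => [|l k la _ IHk]; first by rewrite mulg1.
rewrite mulgA dihedral_orbit_star //.
by apply/eqP => lc; move: (negP ca); rewrite -lc la.
Qed.

Lemma dihedral_orbit_onto n : exists g, dihedral_orbit g = n.
Proof.
elim: n => [|n [g gn]]; first by exists 1; rewrite -word_nil dihedral_orbit_word.
have act l : dihedral_orbit (gen l * g) = dihedral_act l n.
  have [s sE] := wordE g; move: gn; rewrite sE -word_cons !dihedral_orbit_word /=.
  by move=> ->.
exists (gen (if odd n then a else c) * g); rewrite act /dihedral_act.
have ac : (a == c) = false by apply/eqP => ac; move: (negP ca); rewrite -ac star_refl.
by case E: (odd n); rewrite ?ac ?eqxx.
Qed.

End DihedralAction.

(** * Half-twists and the index of the image of [contact_iota] *)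

Section Index.
Variables a b : V.
Hypotheses (ab : a != b) (sab : st a \subset st b).

Lemma star_subset_mem : b \in st a.
Proof. by rewrite star_sym // (fintype.subsetP sab) // star_refl. Qed.

(** The edge [{1, b}] is not dual to this hyperplane, and [b] lies in [<st a>], so translating a
    path by [b] does not change which of its edges cross. *)
Lemma side1_gen_star g : side1 a (gen b * g) = side1 a g.
Proof.
have := paraT g; move: g; apply: para_ind_r => [|c g _ _ IHg].
  by rewrite mulg1 -[gen b]mul1g side1_gen // eq_sym (negbTE ab) addbF.
by rewrite mulgA !side1_gen // IHg paraMl // para_genE star_subset_mem.
Qed.

Definition half_twist g v : W :=
  if side a g v then g * gen b * g^-1 * v else v.

Lemma half_twistK g : involutive (half_twist g).
Proof.
move=> v; rewrite {2}/half_twist; case: ifP => gv; rewrite /half_twist ?gv //.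
have -> : side a g (g * gen b * g^-1 * v) = true.
  by rewrite /side -!mulgA mulKg side1_gen_star -gv.
by rewrite -!mulgA mulKg (mulgA (gen b)) genK mul1g mulVKg.
Qed.

(** Only an edge from [v] to [v a] crossing the hyperplane needs care. There [v] lies in [g<st a>],
    hence in [g<st b>], so the twist maps [v] to [v b]; and [a] in [st l] forces [b] in [st l], so
    [hyp l v] is unchanged. *)
Lemma half_twist_aut g : exists phi, forall l v, phi (hyp l v) = hyp l (half_twist g v).
Proof.
apply: (@involution_aut (fun l _ => l)) => [l v c cl|l v]; last by rewrite half_twistK.
rewrite /half_twist side_gen; case: (c =P a) => [ca|_]; last first.
  by rewrite /= addbF; case: ifP => _; rewrite ?mulgA hyp_gen.
case gv: (para _ _); last by rewrite addbF; case: ifP => _; rewrite ?mulgA hyp_gen.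
have bl : b \in st l.
  by rewrite star_sym // (fintype.subsetP sab) // -ca star_sym.
have twist : hyp l (g * gen b * g^-1 * v) = hyp l v.
  apply/esym/hyp_eq; split=> //; suff -> : v^-1 * (g * gen b * g^-1 * v) = gen b.
    by rewrite para_genE.
  have gv' : para (st b) (g^-1 * v).
    case/paraP: gv => s /allP sa ->; apply: para_word; apply/allP => d /sa.
    exact: (fintype.subsetP sab).
  rewrite -!mulgA (para_star_comm gv') (mulgA g) mulgA mulgA.
  by rewrite -(mulgA v^-1) mulVKg mulVg mul1g.
by rewrite addbT; case: side; rewrite /= ?mulgA hyp_gen // twist.
Qed.


(** The twist at [h] sends [{h, h a}] to [{h, h b a}]. Both ends lie on one side of the different
    hyperplane at [g], so the second twist moves them by the same [r]. The result is not an edge,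
    which keeps the composite from being a cubical automorphism. *)
Lemma half_twist_edge g h : ~~ para (st a) (g^-1 * h) -> exists2 r : W,
  half_twist g (half_twist h h) = r * h &
  half_twist g (half_twist h (h * gen a)) = r * h * gen b * gen a.
Proof.
move=> gh.
have -> : half_twist h h = h by rewrite /half_twist (side_base adj_sym).
have -> : half_twist h (h * gen a) = h * gen b * gen a.
  rewrite /half_twist side_gen (side_base adj_sym) eqxx mulVg para1 /=.
  by rewrite -!mulgA mulKg.
have bh : side a g (h * gen b * gen a) = side a g h.
  rewrite !side_gen (eq_sym b) (negbTE ab) addbF mulgA paraMr.
    by rewrite (negbTE gh) andbF addbF.
  by rewrite para_genE star_subset_mem.
rewrite /half_twist bh; case: ifP => _; last by exists 1; rewrite ?mul1g.
by exists (g * gen b * g^-1); rewrite // !mulgA.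
Qed.

Hypothesis no_cone : forall d, exists e, e \notin st d.

Lemma iota_infinite_index : infinite_index (range (@contact_iota X)).
Proof.
have [c ca] := no_cone a.
(* The [q n] lie in pairwise distinct cosets of [<st a>], so their twists have distinct
   hyperplanes. *)
have /choice[q qE] := dihedral_orbit_onto ca.
have /choice[phi phiE] := half_twist_aut.
have phi_at g v : phi g @` at_ v = at_ (half_twist g v).
  apply/seteqP; split=> [_ [u /(hyperplanes_atP adj_sym adj_irr)[l ->] <-]|u].
    by apply/(hyperplanes_atP adj_sym adj_irr); exists l.
  move=> /(hyperplanes_atP adj_sym adj_irr)[l ->]; exists (hyp l v) => //.
  by apply/(hyperplanes_atP adj_sym adj_irr); exists l.
pose F n := lcoset (phi (q n)) (range (@contact_iota X)).
have Finj : injective F.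
  move=> i j Fij; apply: contrapT => ij.
  have : F j (phi (q j)).
    by exists 1; [exists 1 => //; exact: (multiplicative1 (@contact_iota X))
      | rewrite mulg1].
  rewrite -Fij => -[_ [r _ <-] phi_ij].
  (* Equal cosets give [phi (q j) = phi (q i) * contact_iota r], and half-twists are involutions on
     vertices. *)
  have rE v : r v = half_twist (q i) (half_twist (q j) v).
    rewrite -[LHS](half_twistK (q i)); congr half_twist.
    apply: (hyperplanes_at_inj adj_sym adj_irr no_cone).
    by rewrite -!phi_at -iota_at // -phi_ij image_comp.
  have qij : ~~ para (st a) ((q i)^-1 * q j).
    apply/negP => /(dihedral_orbit_para ca (q i)); rewrite mulVKg !qE.
    by move=> /esym.
  have [y r0 r1] := half_twist_edge qij; rewrite -!rE in r0 r1.
  have /(cube_aut_edge r)/edgeP[z [d]] := edge_ed (q j) a.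
  rewrite image_setU !image_set1 r0 r1 => zd.
  (* These vertices differ in the parities of both [a] and [b], while the ends of an edge differ in
     the parity of one letter only. *)
  have : ed (y * q j) d (y * q j * gen b * gen a).
    by rewrite -(@edE _ _ z) -?zd; [right|left].
  rewrite -mulgA; case=> [/(canRL (mulKg _))|/mulgI];
    move/(congr1 (fun g => (parity a g, parity b g))).
    by rewrite mulVg !parityM !parity1 !parity_gen !eqxx eq_sym (negbTE ab).
  rewrite !parityM !parity_gen !eqxx (eq_sym b) (negbTE ab) /= => -[ad bd].
  by move: ab; rewrite -(eqP (esym ad)) -(eqP (esym bd)) eqxx.
apply/infiniteP; apply: (card_le_trans (B := range F)).
  by have := @inj_card_eq _ _ setT F (in2W Finj); rewrite card_eq_le => /andP[].
by apply: subset_card_le => _ [n _ <-]; exists (phi (q n)).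
Qed.
End Index.

(** * The kernel of [rho] *)

Section Kernel.
Hypothesis no_cone : forall d, exists e, e \notin st d.
Local Notation rho := (rho adj_sym adj_irr no_cone).

Lemma kernel_rhoP phi : kernel rho phi <-> forall v, phi @` at_ v = at_ v.
Proof.
split=> [phi1 v|phi1].
  by rewrite -(rho_funP adj_sym adj_irr no_cone) -[rho_fun _ _ _ _ _]/(rho phi v) phi1.
apply: symP; apply/funext => v; apply: (hyperplanes_at_inj adj_sym adj_irr no_cone).
by rewrite [LHS](rho_funP adj_sym adj_irr no_cone) phi1.
Qed.

Lemma kernel_rho_hyp phi v a : kernel rho phi -> exists b, phi (hyp a v) = hyp b v.
Proof.
move=> /kernel_rhoP/(_ v) phiv; apply/(hyperplanes_atP adj_sym adj_irr).
by rewrite -phiv; exists (hyp a v) => //; apply/(hyperplanes_atP adj_sym adj_irr); exists a.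
Qed.

Lemma torsion_kernel_rho : torsion (kernel rho).
Proof.
(* An element of the kernel permutes the labels at each vertex, so the order of the symmetric group
   on [V] is an exponent valid at all vertices at once. *)
move=> phi phi1; exists #|[set: {perm V}]%G|; first exact: cardG_gt0.
apply: val_inj; apply: symP; apply/funext => u; have [a [v ->]] := hypP u.
have /choice[p pE] := fun b => kernel_rho_hyp v b phi1.
have pinj : injective p.
  move=> b c bc; have : phi (hyp b v) = phi (hyp c v) by rewrite !pE bc.
  by move/aut_inj => /hyp_eq[].
have iterE n : (phi ^+ n) (hyp a v) = hyp (iter n p a) v.
  elim: n => [|n IHn] //=; rewrite expgS; transitivity (phi ((phi ^+ n) (hyp a v))) => //.
  by rewrite IHn pE.
rewrite [LHS]iterE; have /permP/(_ a) := 
  expg_cardG (finset.in_setT (perm pinj) : perm pinj \in [set: {perm V}]%G).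
rewrite permX perm1 => pa; congr hyp; rewrite -[RHS]pa.
by apply: eq_iter => b; rewrite permE.
Qed.

(** An element of the kernel preserves the vertex set of every carrier. If it relabels [a] as [b] at
    [v], then [v<st a>] and [v<st b>] coincide. *)
Lemma rho_not_inj phi : kernel rho phi -> phi <> 1 -> exists a b, a != b /\ st a = st b.
Proof.
move=> phi1 nphi; apply: contrapT => nab; apply: nphi.
apply: val_inj; apply: symP; apply/funext => u; have [a [v ->]] := hypP u.
have [b bE] := kernel_rho_hyp v a phi1; rewrite [LHS]bE; congr hyp.
apply/eqP/negPn/negP => ba; apply: nab; exists b, a; split=> //.
have stE k : para (st a) k <-> para (st b) k.
  have aut_at : forall w y, at_ y (phi w) <-> at_ y w.
    move=> w y; have /kernel_rhoP/(_ y) phiy := phi1.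
    by rewrite -{1}phiy; split=> [[w' yw' /aut_inj <-]|yw] //; exists w.
  have := aut_at (hyp a v) (v * k); rewrite bE !hyp_at mulKg.
  by case=> ? ?; split.
by apply/setP => c; rewrite -!(para_genE (adj := adj)); apply/idP/idP => /stE.
Qed.

Section Swap.
Variables a b c : V.
Hypotheses (ab : a != b) (sab : st a = st b) (ca : c \notin st a).

(** The index [dihedral_orbit a c v] changes only under right multiplication by [c], and a label [l]
    with [c] in [st l] is neither [a] nor [b], hence not swapped. So the swap can be switched on or
    off separately for each index. *)
Lemma swap_aut (F : set nat) : exists phi, forall l v,
  phi (hyp l v) =
  hyp (if `[< F (dihedral_orbit a c v) >] then tperm a b l else l) v.
Proof.
pose f l v := if `[< F (dihedral_orbit a c v) >] then tperm a b l else l.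
apply: (@involution_aut f id); rewrite /f.
  move=> l v d dl; have st_tperm : st (tperm a b l) = st l.
    by case: tpermP => [->|->|].
  have [dc|dc] := eqVneq d c; last first.
    by rewrite dihedral_orbit_star //; case: ifP => _; rewrite hyp_gen ?st_tperm.
  have tl : tperm a b l = l.
    by apply: tpermD; apply/eqP => lE; move: (negP ca); rewrite -dc ?lE ?sab ?lE dl.
  by rewrite tl !if_same hyp_gen.
by move=> l v; case: `[< _ >]; rewrite ?tpermK.
Qed.

(** Every natural number is the index of some vertex, so [F] can be read off from the images of the
    hyperplanes labelled [a]. *)
Lemma swap_kernel : exists2 phi : set nat -> graph_aut (contact_graph X),
  injective phi & forall F, kernel rho (phi F).
Proof.
have /choice[phi phiE] := swap_aut; exists phi => [F G FG|F].
  apply/funext => n; have [g gn] := dihedral_orbit_onto ca n.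
  have := phiE F a g; rewrite FG phiE gn tpermL => /hyp_eq[].
  have ba : b = a -> False by move=> ba; move: (negP ab); rewrite ba eqxx.
  by move=> FGn _; apply/propext; move: FGn; do 2!case: asboolP => //; move=> ? ? // /esym.
apply/kernel_rhoP => v; apply/seteqP; split=> [_ [u + <-]|u].
  move=> /(hyperplanes_atP adj_sym adj_irr)[l ->].
  by apply/(hyperplanes_atP adj_sym adj_irr); rewrite phiE; eexists.
move=> /(hyperplanes_atP adj_sym adj_irr)[l ->].
exists (hyp (if `[< F (dihedral_orbit a c v) >] then tperm a b l else l) v).
  by apply/(hyperplanes_atP adj_sym adj_irr); eexists.
by rewrite phiE; case: `[< _ >]; rewrite ?tpermK.
Qed.

Lemma kernel_rho_uncountable : ~ countable (kernel rho).
Proof.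
have [phi phiI phiK] := swap_kernel => /countable_injP[j jinj].
(* Cantor's diagonal set for the injection [j] of the kernel into [nat]. *)
pose D n := exists2 F : set nat, j (phi F) = n & ~ F n.
have nD : ~ D (j (phi D)).
  move=> DD; have [F jF nF] := DD; apply: nF.
  suff -> : F = D by [].
  by apply/phiI/jinj; rewrite ?in_setE.
by apply: (nD); exists D.
Qed.

End Swap.

Lemma rho_injectiveP : injective rho <-> ~ exists a b, a != b /\ st a = st b.
Proof.
split=> [/(multiplicative_injP rho) rinj [a [b [ab sab]]]|nab]; last first.
  by apply/(multiplicative_injP rho) => phi phi1; apply: contrapT => /(rho_not_inj phi1).
have [c ca] := no_cone a; apply: (kernel_rho_uncountable ab sab ca).
apply: (@sub_countable _ _ _ [set 1]); last exact: countable1.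
by apply: subset_card_le => phi /rinj.
Qed.

End Kernel.

End ContactAutomorphisms.

Theorem mainTheorem3 (V : finType) (adj : rel V)
    (adj_sym : symmetric adj) (adj_irr : irreflexive adj)
    (no_factor : no_finite_direct_factor (racg adj)) :
  [/\
      (forall v : vertex (davis adj), ~ extremal v) /\
      injective (@contact_iota (davis adj)),
      ((exists (h : hyperplane (davis adj)) (v : vertex (hyperplane_complex h)),
          extremal v) <->
       (exists a b : V, a != b /\ star adj a \subset star adj b)) /\
      ((exists (h : hyperplane (davis adj)) (v : vertex (hyperplane_complex h)),
          extremal v) ->
       infinite_index (range (@contact_iota (davis adj)))) &
      exists rho : {multiplicative graph_aut (contact_graph (davis adj)) ->
                                   sym (vertex (davis adj))},
        [/\ forall phi v, hyperplanes_at (rho phi v) = phi @` hyperplanes_at v,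
            forall rho' : graph_aut (contact_graph (davis adj)) ->
                          sym (vertex (davis adj)),
              (forall phi v,
                 hyperplanes_at (rho' phi v) = phi @` hyperplanes_at v) ->
              rho' =1 rho,
            injective rho <-> ~ (exists a b : V, a != b /\ star adj a = star adj b) &
            ~ injective rho -> ~ countable (kernel rho) /\ torsion (kernel rho)]].
Proof.
(* The hypothesis on direct factors enters only through the absence of a vertex adjacent to all
   others. *)
have no_cone := no_factor_no_cone no_factor.
split.
- split; first exact: davis_not_extremal no_cone.
  exact: iota_inj adj_sym adj_irr no_cone.
- have extP := extremal_hyperplane_vertexP adj_sym adj_irr.
  split=> // /extP[a [b [ab sab]]].
  exact: iota_infinite_index adj_sym adj_irr _ _ ab sab no_cone.
exists (rho adj_sym adj_irr no_cone); split.
- exact: rho_funP.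
- move=> rho' rho'P phi; apply: symP; apply/funext => v.
  apply: (hyperplanes_at_inj adj_sym adj_irr no_cone).
  by rewrite rho'P [RHS]rho_funP.
- exact: rho_injectiveP.
move=> ninj; split; last exact: torsion_kernel_rho.
have [a [b [ab sab]]] : exists a b, a != b /\ star adj a = star adj b.
  by apply: contrapT => /(rho_injectiveP adj_sym adj_irr no_cone).
have [c ca] := no_cone a.
exact: kernel_rho_uncountable ab sab ca.
Qed.
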